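(* Suppose $A\in M_d(\mathbb C)^g$ and $B\in M_e(\mathbb C)^g$ are sv-generic and $\mathcal D_A$ is bounded. If $p$ is a birational map between $\mathcal D_A$ and $\mathcal D_B$ with $p(0)=0$ and $p'(0)=I_g$, then (1) $d=e$; (2) there exists a $d\times d$ matrix $C$ such that $B$ is unitarily equivalent to $CA=(CA_1,\dots,CA_g)$, i.e. there is a unitary $U$ with $B_j=U^*CA_jU$ for all $j$; (3) the tuple $R=(C-I)A=((C-I)A_1,\dots,(C-I)A_g)$ spans an algebra $\mathcal R$; (4) the span of $A_1,\dots,A_g$ is a right $\mathcal R$-module; and (5) letting $\Xi=(\Xi_1,\dots,\Xi_g)\in M_g(\mathbb C)^g$ denote the structure matrices for this module, i.e. $A_kR_j=\sum_{s=1}^g(\Xi_j)_{k,s}A_s$ for $1\le j,k\le g$, the tuple $\Xi$ is convexotonic and $p$ is the convexotonic map $$p(x)=x\,(I-\Lambda_\Xi(x))^{-1}.$$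
   Context: For $A\in M_d(\mathbb C)^g$ and freely noncommuting variables $x=(x_1,\dots,x_g)$ put $\Lambda_A(x)=\sum_jA_jx_j$ and $L_A(x)=I_d+\Lambda_A(x)+\Lambda_A(x)^*$, evaluated at $X\in M_n(\mathbb C)^g$ by $\Lambda_A(X)=\sum_jA_j\otimes X_j$, $L_A(X)=I+\Lambda_A(X)+\Lambda_A(X)^*$. The free spectrahedron $\mathcal D_A$ is the sequence $(\mathcal D_A(n))_n$, $\mathcal D_A(n)=\{X\in M_n(\mathbb C)^g: L_A(X)\succeq0\}$; it is bounded if there is a constant $N$ with $\|X\|\le N$ for all $n$ and all $X\in\mathcal D_A(n)$. A set $\{u^1,\dots,u^{d+1}\}$ is a hyperbasis for $\mathbb C^d$ if each $d$-element subset is a basis. The tuple $A\in M_d(\mathbb C)^g$ is sv-generic if there exist $\alpha^1,\dots,\alpha^{d+1}$ and $\beta^1,\dots,\beta^d$ in $\mathbb C^g$ such that: for each $j$, $I-\Lambda_A(\alpha^j)^*\Lambda_A(\alpha^j)$ is positive semidefinite with one-dimensional kernel spanned by $u^j$, and $\{u^1,\dots,u^{d+1}\}$ is a hyperbasis for $\mathbb C^d$; and for each $k$, $I-\Lambda_A(\beta^k)\Lambda_A(\beta^k)^*$ is positive semidefinite with kernel spanned by a vector $v^k$, and $\{v^1,\dots,v^d\}$ is a basis for $\mathbb C^d$. A free rational function regular at $0$ is an expression $r(x)=c^*(I-\Lambda_E(x))^{-1}b$ with $E\in M_m(\mathbb C)^g$, $b,c\in\mathbb C^m$; its domain consists of the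 tuples at which it is regular. A birational map between $\mathcal D_A$ and $\mathcal D_B$ is a mapping $p=(p^1,\dots,p^g)$ with free rational entries, with $\mathcal D_A$ in its domain, mapping $\mathcal D_A$ into $\mathcal D_B$, and having an inverse $q:\mathcal D_B\to\mathcal D_A$ that is also a free rational mapping ($p\circ q$ and $q\circ p$ are the identities on $\mathcal D_B$ and $\mathcal D_A$). The condition $p(0)=0$, $p'(0)=I_g$ means $p(x)=x+(\text{terms of degree}\ge2)$. Here $x$ is a row vector, so $p(x)=x(I-\Lambda_\Xi(x))^{-1}$ has entries $p^i(x)=\sum_jx_j\big((I-\Lambda_\Xi(x))^{-1}\big)_{j,i}$. A tuple $\Xi\in M_g(\mathbb C)^g$ is convexotonic if $\Xi_k\Xi_j=\sum_s(\Xi_j)_{k,s}\Xi_s$ for all $1\le j,k\le g$. *)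

(* Defs.v *)
From HB Require Import structures.
From mathcomp Require Import all_boot all_order all_algebra.
From mathcomp Require Import classical_sets reals.
From mathcomp Require Export complex mxtens.

Set Implicit Arguments.
Unset Strict Implicit.
Unset Printing Implicit Defensive.

Import Order.TTheory GRing.Theory Num.Theory.
Local Open Scope ring_scope.
Local Open Scope complex_scope.
Local Open Scope sesquilinear_scope.
Local Open Scope classical_set_scope.

Section FreeSpectrahedra.
Variable R : realType.
Local Notation C := R[i].

(* The order of [R[i]] only compares numbers with equal imaginary parts, so
   this forces [v^* M v] to be real, hence [M] to be Hermitian. *)
Definition psdmx n (M : 'M[C]_n) : Prop :=
  forall v : 'cV[C]_n, 0 <= (v^t* *m M *m v) 0 0.

Definition l2norm n (v : 'cV[C]_n) : R :=
  Num.sqrt (\sum_i ComplexField.Normc.normc (v i 0) ^+ 2).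

Definition opnorm n (M : 'M[C]_n) : R :=
  sup [set l2norm (M *m v) | v in [set v : 'cV[C]_n | l2norm v <= 1]].

Definition opnorm_tuple g n (X : 'I_g -> 'M[C]_n) : R :=
  \big[Num.max/0]_(j < g) opnorm (X j).

Definition Lambda g d n (A : 'I_g -> 'M[C]_d) (X : 'I_g -> 'M[C]_n) :
  'M[C]_(d * n) := \sum_j A j *t X j.

Definition Lambda_pt g d (A : 'I_g -> 'M[C]_d) (a : 'rV[C]_g) : 'M[C]_d :=
  \sum_j a 0 j *: A j.

Definition monic_pencil g d n (A : 'I_g -> 'M[C]_d) (X : 'I_g -> 'M[C]_n) :
  'M[C]_(d * n) := 1%:M + Lambda A X + (Lambda A X)^t*.

Definition free_spectrahedron g d (A : 'I_g -> 'M[C]_d) (n : nat) :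
  set ('I_g -> 'M[C]_n) := [set X | psdmx (monic_pencil A X)].

Definition bounded_free_spectrahedron g d (A : 'I_g -> 'M[C]_d) : Prop :=
  exists N : R, forall n (X : 'I_g -> 'M[C]_n),
    free_spectrahedron A X -> opnorm_tuple X <= N.

Definition basis_family d (u : 'I_d -> 'cV[C]_d) : Prop :=
  basis_of fullv [seq u i | i : 'I_d].

Definition hyperbasis d (u : 'I_d.+1 -> 'cV[C]_d) : Prop :=
  forall i : 'I_d.+1, basis_family (fun k : 'I_d => u (lift i k)).

(* [kermx] is the kernel for row vectors, whence the transpositions. *)
Definition kernel_spanned_by d (M : 'M[C]_d) (u : 'cV[C]_d) : Prop :=
  (kermx M^T == u^T)%MS.

Definition sv_generic g d (A : 'I_g -> 'M[C]_d) : Prop :=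
  exists (alpha : 'I_d.+1 -> 'rV[C]_g) (beta : 'I_d -> 'rV[C]_g)
         (u : 'I_d.+1 -> 'cV[C]_d) (v : 'I_d -> 'cV[C]_d),
  [/\ forall j,
        let M := 1%:M - (Lambda_pt A (alpha j))^t* *m Lambda_pt A (alpha j) in
        [/\ psdmx M, \rank (kermx M^T) = 1%N & kernel_spanned_by M (u j)],
      hyperbasis u,
      forall k,
        let M := 1%:M - Lambda_pt A (beta k) *m (Lambda_pt A (beta k))^t* in
        psdmx M /\ kernel_spanned_by M (v k) &
      basis_family v].

(* The expression [c^* (I - Lambda_E(x))^-1 b] in [g] freely noncommuting
   variables. *)
Record free_rational (g : nat) := FreeRational {
  fr_dim : nat;
  fr_E : 'I_g -> 'M[C]_fr_dim;
  fr_b : 'cV[C]_fr_dim;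
  fr_c : 'cV[C]_fr_dim }.

Definition fr_regular g (r : free_rational g) n (X : 'I_g -> 'M[C]_n) : Prop :=
  1%:M - Lambda (fr_E r) X \in unitmx.

(* Meaningful only where [r] is regular: [invmx M] is [M] itself if [M] is
   singular. *)
Definition fr_eval g (r : free_rational g) n (X : 'I_g -> 'M[C]_n) : 'M[C]_n :=
  castmx (mul1n n, mul1n n)
    (((fr_c r)^t* *t 1%:M) *m invmx (1%:M - Lambda (fr_E r) X)
       *m (fr_b r *t 1%:M)).

(* Coefficient of [x_(w_1) ... x_(w_k)] in the power series expansion
   [c^* (\sum_k Lambda_E(x)^k) b] of [r] at 0. *)
Definition fr_coef g (r : free_rational g) (w : seq 'I_g) : C :=
  ((fr_c r)^t* *m foldr (fun j M => fr_E r j *m M) 1%:M w *m fr_b r) 0 0.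

Definition free_rational_map (g : nat) := 'I_g -> free_rational g.

Definition frm_regular g (p : free_rational_map g) n (X : 'I_g -> 'M[C]_n) :
  Prop := forall i, fr_regular (p i) X.

Definition frm_eval g (p : free_rational_map g) n (X : 'I_g -> 'M[C]_n) :
  'I_g -> 'M[C]_n := fun i => fr_eval (p i) X.

Definition frm_maps g d e (p : free_rational_map g)
    (A : 'I_g -> 'M[C]_d) (B : 'I_g -> 'M[C]_e) : Prop :=
  forall n (X : 'I_g -> 'M[C]_n), free_spectrahedron A X ->
    frm_regular p X /\ free_spectrahedron B (frm_eval p X).

Definition birational_between g d e (p : free_rational_map g)
    (A : 'I_g -> 'M[C]_d) (B : 'I_g -> 'M[C]_e) : Prop :=
  frm_maps p A B /\
  exists q : free_rational_map g,
  [/\ frm_maps q B A,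
      forall n (X : 'I_g -> 'M[C]_n), free_spectrahedron A X ->
        frm_eval q (frm_eval p X) =1 X &
      forall n (Y : 'I_g -> 'M[C]_n), free_spectrahedron B Y ->
        frm_eval p (frm_eval q Y) =1 Y].

Definition vanishes_at_0 g (p : free_rational_map g) : Prop :=
  forall i, fr_coef (p i) [::] = 0.

Definition derivative_at_0_is_id g (p : free_rational_map g) : Prop :=
  forall i j, fr_coef (p i) [:: j] = (i == j)%:R.

Definition tuple_span g d (A : 'I_g -> 'M[C]_d) : {vspace 'M[C]_d} :=
  <<[seq A j | j : 'I_g]>>%VS.

(* Not required to be unital. *)
Definition is_matrix_algebra d (V : {vspace 'M[C]_d}) : Prop :=
  forall S T, S \in V -> T \in V -> S *m T \in V.

Definition is_right_module d (V W : {vspace 'M[C]_d}) : Prop :=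
  forall S T, S \in V -> T \in W -> S *m T \in V.

Definition structure_matrices g d (A S : 'I_g -> 'M[C]_d)
    (Xi : 'I_g -> 'M[C]_g) : Prop :=
  forall j k, A k *m S j = \sum_s Xi j k s *: A s.

Definition convexotonic g (Xi : 'I_g -> 'M[C]_g) : Prop :=
  forall j k, Xi k *m Xi j = \sum_s Xi j k s *: Xi s.

Definition mxtens_block g n (M : 'M[C]_(g * n)) (j i : 'I_g) : 'M[C]_n :=
  \matrix_(a, b) M (mxtens_index (j, a)) (mxtens_index (i, b)).

(* [x (I - Lambda_Xi(x))^-1] with [x] a row vector. *)
Definition convexotonic_map g (Xi : 'I_g -> 'M[C]_g)
    n (X : 'I_g -> 'M[C]_n) : 'I_g -> 'M[C]_n :=
  fun i => \sum_j X j *m mxtens_block (invmx (1%:M - Lambda Xi X)) j i.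

(* Equality as functions; at level [n] the domain of [p] is the set of [X] with
   [frm_regular p X], and the resolvent must exist there. *)
Definition is_convexotonic_map g (p : free_rational_map g)
    (Xi : 'I_g -> 'M[C]_g) : Prop :=
  forall n (X : 'I_g -> 'M[C]_n), frm_regular p X ->
    1%:M - Lambda Xi X \in unitmx /\ frm_eval p X =1 convexotonic_map Xi X.

End FreeSpectrahedra.

(* Main.v *)
(** Write [S = (C - 1) A] and let [p_w] be the coefficient of the word
    [w] in [p].  Everything follows from a sum-of-squares certificate for
    [L_B(p(x)) >= 0], truncated at words of length [N]: there are matrices
    [W_(s,w)] with [L_B(p(x)) = sum_s W_s(x)^* (L_A (+) 1)(x) W_s(x)], where
    [W_s(x) = sum_w W_(s,w) w].  If no certificate existed, a conic Farkas lemma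
    would give a positive functional, which after a small perturbation is
    [G |-> tr (K K^* G)] with [K] invertible; the truncated shifts conjugated by
    [K] would then be a nilpotent tuple [X] in [D_A] with [p(X)] not in [D_B].

    Put [G_(s,jw) = W_(s,jw) + A_j W_(s,w)].  Comparing coefficients gives
    [sum_s W_(s,1)^* W_(s,1) = 1],
    [sum_s W_(s,1)^* G_(s,jw) = sum_i p^i_(jw) B_i] and
    [sum_s G_(s,iv)^* G_(s,jw) = sum_s W_(s,v)^* A_i^* A_j W_(s,w)].
    The constant terms [W_(s,1)] for [p] composed with those for its inverse fix
    every line [C u^j], so by the hyperbasis property the composites are scalars.
    Hence [d = e], [W_(s,1) = k_s U] with [U] unitary, and [U B_j U^* = C A_j] with
    [C] unitary.  Cases of equality in Bessel's inequality then give
    [W_(s,w) = k_s S_w U] and [sum_i p^i_(jw) A_i = A_j S_w] by induction on the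
    word [w], which determines [p]. *)

Require Import Defs.
From HB Require Import structures.
From mathcomp Require Import all_boot all_order all_algebra.
From mathcomp Require Import classical_sets reals.
From mathcomp Require Import boolp topology normedtype derive.
From mathcomp Require Import ring lra.

Set Implicit Arguments.
Unset Strict Implicit.
Unset Printing Implicit Defensive.

Import Order.TTheory GRing.Theory Num.Theory.
Local Open Scope ring_scope.

(** * Conic Farkas lemma *)

Section Farkas.
Import numFieldNormedType.Exports.
Local Open Scope classical_set_scope.
Variables (R : realType).

Lemma cvg_sumr (T : topologicalType) I (r : seq I) (F : I -> T -> R) (x : T) :
  (forall i, F i y @[y --> x] --> F i x) ->
  (\sum_(i <- r) F i y) @[y --> x] --> \sum_(i <- r) F i x.
Proof.
move=> Fc; elim: r => [|i r IHr].
  by under eq_fun do rewrite big_nil; rewrite big_nil; exact: cvg_cst.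
under eq_fun do rewrite big_cons.
by rewrite big_cons; apply: cvgD.
Qed.

Definition dotr n (x y : 'rV[R]_n) : R := \sum_i x 0 i * y 0 i.

Lemma dotrDr n (x y z : 'rV[R]_n) : dotr x (y + z) = dotr x y + dotr x z.
Proof. by rewrite -big_split /=; apply: eq_bigr => i _; rewrite mxE mulrDr. Qed.

Lemma dotrC n (x y : 'rV[R]_n) : dotr x y = dotr y x.
Proof. by apply: eq_bigr => i _; rewrite mulrC. Qed.

Lemma dotrZr n a (x y : 'rV[R]_n) : dotr x (a *: y) = a * dotr x y.
Proof. by rewrite mulr_sumr; apply: eq_bigr => i _; rewrite mxE mulrCA. Qed.

Lemma dotrNr n (x y : 'rV[R]_n) : dotr x (- y) = - dotr x y.
Proof. by rewrite -scaleN1r dotrZr mulN1r. Qed.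

Lemma dotrBr n (x y z : 'rV[R]_n) : dotr x (y - z) = dotr x y - dotr x z.
Proof. by rewrite dotrDr dotrNr. Qed.

Lemma dotrDl n (x y z : 'rV[R]_n) : dotr (x + y) z = dotr x z + dotr y z.
Proof. by rewrite dotrC dotrDr !(dotrC z). Qed.

Lemma dotrNl n (x y : 'rV[R]_n) : dotr (- x) y = - dotr x y.
Proof. by rewrite dotrC dotrNr dotrC. Qed.

Lemma dotr0 n (x : 'rV[R]_n) : dotr x 0 = 0.
Proof. by apply: big1 => i _; rewrite mxE mulr0. Qed.

Lemma dotr_sumr n I r (P : pred I) (x : 'rV[R]_n) (F : I -> 'rV[R]_n) :
  dotr x (\sum_(i <- r | P i) F i) = \sum_(i <- r | P i) dotr x (F i).
Proof. exact: (big_morph _ (dotrDr x) (dotr0 x)). Qed.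

Lemma dotr_ge0 n (x : 'rV[R]_n) : 0 <= dotr x x.
Proof. by apply: sumr_ge0 => i _; rewrite -expr2 sqr_ge0. Qed.

Lemma dotr_eq0 n (x : 'rV[R]_n) : dotr x x = 0 -> x = 0.
Proof.
move=> /eqP; rewrite psumr_eq0 => [/allP x0|i _]; last by rewrite -expr2 sqr_ge0.
apply/rowP => i; have := x0 i (mem_index_enum _).
by rewrite /= mulf_eq0 orbb mxE => /eqP.
Qed.

(** First variation: the derivative at 0 of the squared norm of [x - t *: y] is [-2 * dotr x y]. *)
Lemma dotr_le0_of_min n (x y : 'rV[R]_n) :
  (forall t, 0 < t <= 1 -> dotr x x <= dotr (x - t *: y) (x - t *: y)) ->
  dotr x y <= 0.
Proof.
move=> H; rewrite leNgt; apply/negP => xy_gt0.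
(* The quadratic in [t] is minimal at [dotr x y / dotr y y]. The extra summand in the denominator
   keeps it nonzero and [t] at most 1, and the value still drops strictly. *)
pose t := dotr x y / (dotr x y + dotr y y).
have s0 : 0 < dotr x y + dotr y y by rewrite ltr_wpDr ?dotr_ge0.
have t0 : 0 < t by rewrite divr_gt0.
have t1 : t <= 1 by rewrite ler_pdivrMr // mul1r lerDl dotr_ge0.
have := H t; rewrite t0 t1 => /(_ isT).
rewrite !(dotrDl, dotrBr, dotrNl, dotrZr) (dotrC _ x) dotrZr (dotrC (t *: y)) dotrZr.
rewrite leNgt => /negP; apply.
suff : t * dotr y y < 2 * dotr x y by have := t0; nra.
have h : t * (dotr x y + dotr y y) = dotr x y by rewrite divfK // gt_eqF.
have := dotr_ge0 y; nra.
Qed.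

Variables (m M : nat) (q : 'rV[R]_m -> 'rV[R]_M).
Hypothesis qc : forall l, continuous (fun v => q v 0 l).
Hypothesis qh : forall t v, q (t *: v) = t ^+ 2 *: q v.

(* Caratheodory: one of [M + 1] vectors can be freed; it then serves for the
   variation at a minimizer. *)
Lemma conic_free_row (V : 'I_M.+1 -> 'rV[R]_m) :
  exists V' : 'I_M.+1 -> 'rV[R]_m,
    \sum_s q (V' s) = \sum_s q (V s) /\ exists s0, V' s0 = 0.
Proof.
pose Q := \matrix_s q (V s).
have : exists2 mu : 'rV[R]_M.+1, mu *m Q = 0 & exists s, 0 < mu 0 s.
  have : kermx Q != 0.
    by rewrite kermx_eq0 /row_free neq_ltn ltnS (rank_leq_col Q).
  case/rowV0Pn => mu /sub_kermxP muQ /rV0Pn[s mus].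
  have [h|h] := ltP 0 (mu 0 s); first by exists mu => //; exists s.
  exists (- mu); first by rewrite mulNmx muQ oppr0.
  by exists s; rewrite mxE oppr_gt0 lt_neqAle mus.
case=> mu muQ [s1 mus1].
have [s0 mumax] : exists s0, forall s, mu 0 s <= mu 0 s0.
  pose s0 := [arg max_(s > s1) mu 0 s]%O; exists s0 => s.
  by rewrite /s0; case: arg_maxP => // s2 _; exact.
have mus0 : 0 < mu 0 s0 by rewrite (lt_le_trans mus1) ?mumax.
(* By homogeneity this subtracts a multiple of the relation [mu *m Q = 0] from the sum. Maximality
   of [mu 0 s0] keeps the radicands nonnegative, and the slot [s0] becomes zero. *)
exists (fun s => Num.sqrt (1 - mu 0 s / mu 0 s0) *: V s); split; last first.
  by exists s0; rewrite divff ?gt_eqF // subrr sqrtr0 scale0r.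
transitivity (\sum_s (q (V s) - (mu 0 s0)^-1 *: (mu 0 s *: q (V s)))).
  apply: eq_bigr => s _; rewrite qh sqr_sqrtr.
    by rewrite scalerBl scale1r scalerA mulrC.
  by rewrite subr_ge0 ler_pdivrMr // mul1r mumax.
rewrite sumrB -scaler_sumr.
suff -> : \sum_s mu 0 s *: q (V s) = mu *m Q by rewrite muQ scaler0 subr0.
by rewrite mulmx_sum_row; apply: eq_bigr => s _; rewrite rowK.
Qed.

Lemma continuous_conic_sum K l :
  continuous (fun V : 'rV[R]_(K * m) => (\sum_s q (row s (vec_mx V))) 0 l).
Proof.
have -> : (fun V : 'rV[R]_(K * m) => (\sum_s q (row s (vec_mx V))) 0 l) =
          (fun V => \sum_s q (row s (vec_mx V)) 0 l).
  by apply/funext => V; rewrite summxE.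
move=> V; apply: cvg_sumr => s.
suff h : {for V, continuous (fun W : 'rV[R]_(K * m) => row s (vec_mx W))}.
  exact: (continuous_comp h (@qc l _)).
rewrite /prop_for /continuous_at; apply/(@cvgrPdist_le _ _ _ (nbhs V)) => e e0.
near=> W.
have VWe : `|V - W| <= e by near: W; exact: cvgr_dist_le cvg_id _ e0.
rewrite /Num.norm /= mx_normrE; apply: bigmax_le; first exact: ltW.
case=> i j _ /=; rewrite !mxE.
apply: le_trans VWe; rewrite [leRHS]/Num.norm /= mx_normrE.
apply: le_trans (le_bigmax _ _ (0, mxvec_index s j)) => /=.
by rewrite !mxE.
Unshelve. all: by end_near. Qed.

(** The functional [c0] makes the residual coercive: it bounds the squared length of a family by a
    linear function of its sum, so a small residual confines the family to a ball, which is
    compact. *)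
Lemma conic_residual_min (c0 tau : 'rV[R]_M) K :
  (forall v, dotr v v <= dotr c0 (q v)) ->
  let f := fun V : 'I_K -> 'rV[R]_m =>
    dotr (tau - \sum_s q (V s)) (tau - \sum_s q (V s)) in
  exists V0, forall V, f V0 <= f V.
Proof.
move=> hc0 f; pose F (V : 'rV[R]_(K * m)) := f (fun s => row s (vec_mx V)).
have cF : continuous F.
  move=> V; rewrite /F /f /dotr; apply: cvg_sumr => l.
  have h : (fun W : 'rV[R]_(K * m) =>
              (tau - \sum_s q (row s (vec_mx W))) 0 l) @ V -->
           (tau - \sum_s q (row s (vec_mx V))) 0 l.
    have -> : (fun W : 'rV[R]_(K * m) =>
              (tau - \sum_s q (row s (vec_mx W))) 0 l) =
              (fun W => tau 0 l - (\sum_s q (row s (vec_mx W))) 0 l).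
      by apply/funext => W; rewrite mxE [X in _ + X]mxE.
    rewrite mxE [X in _ + X]mxE.
    exact: (cvgB (cvg_cst _) (@continuous_conic_sum K l V)).
  exact: (cvgM h h).
(* If [V] does better than 0 and has sum [x], then [dotr c0 x] is at most [b], by the inequality of
   the means applied to [c0] and [tau - x]. Hence the squared norm of [V] is at most [b], and [V]
   lies in the ball of radius [b + 1]. *)
pose b : R := dotr c0 tau + dotr c0 c0 + dotr tau tau.
pose A := [set V : 'rV[R]_(K * m) | `|V| <= b + 1].
have b0 : 0 <= b.
  have := dotr_ge0 (c0 + tau); have := dotr_ge0 c0; have := dotr_ge0 tau.
  rewrite dotrDl !dotrDr (dotrC tau c0) /b; lra.
have far V : ~ A V -> F 0 <= F V.
  rewrite /A /= => /negP; rewrite -ltNge => bV.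
  have F0 : F 0 = dotr tau tau.
    rewrite /F /f big1 ?subr0 // => s _; rewrite linear0 row0.
    by rewrite -(scale0r 0) qh expr0n scale0r.
  rewrite F0 leNgt; apply/negP => FV.
  set x := \sum_s q (row s (vec_mx V)) in FV *.
  have VV : dotr V V <= dotr c0 x.
    rewrite dotr_sumr; apply: le_trans (ler_sum _ (fun s _ => hc0 _)).
    rewrite /dotr (reindex _ (curry_mxvec_bij _ _)) /= pair_big /=.
    rewrite le_eqVlt; apply/orP; left; apply/eqP; apply: eq_bigr => -[i j] _.
    by rewrite !mxE.
  have sV : `|V| ^+ 2 <= dotr V V.
    rewrite -[leRHS]sqr_sqrtr ?dotr_ge0 // ler_sqr ?nnegrE ?sqrtr_ge0 //.
    rewrite [leLHS]/Num.norm /= mx_normrE; apply: bigmax_le; first exact: sqrtr_ge0.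
    case=> i j _ /=; rewrite ord1 -[leLHS]ger0_norm // -sqrtr_sqr ler_sqrt ?dotr_ge0 //.
    rewrite real_normK ?num_real // /dotr (bigD1 j) //= -expr2 lerDl.
    by apply: sumr_ge0 => k _; rewrite -expr2 sqr_ge0.
  have := dotr_ge0 (c0 + (tau - x)).
  have := dotr_ge0 (c0 - (tau - x)); move: FV; rewrite /F /f -/x.
  rewrite !(dotrDl, dotrBr, dotrDr, dotrNr, dotrNl).
  rewrite !(dotrC tau c0) !(dotrC x c0) !(dotrC x tau).
  move: VV sV bV b0; rewrite /b; set nV := `|V|; nra.
have A0 : A 0 by rewrite /A /= normr0 addr_ge0.
have cA : compact A.
  apply: bounded_closed_compact.
    by exists (b + 1); split; [exact: num_real|move=> y yb V /le_trans; apply; exact: ltW].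
  have -> : A = (fun V => `|V|) @^-1` [set x | x <= b + 1] by [].
  apply: closed_comp; last exact: closed_le.
  by move=> V _; exact: norm_continuous.
have [|V0 _ minV0] := @compact_EVT_min _ _ F A (ex_intro _ _ A0) cA.
  by move=> x; apply: continuous_subspaceT => ?; exact: cF.
exists (fun s => row s (vec_mx V0)) => V.
have -> : f V = F (mxvec (\matrix_s V s)).
  by rewrite /F mxvecK; congr f; apply/funext => s; rewrite rowK.
have [AV|/far] := pselect (A (mxvec (\matrix_s V s))).
  by apply: minV0; rewrite inE.
by apply: le_trans; apply: minV0; rewrite inE.
Qed.

(** The residual [r] of a nearest point to [tau] in the cone of sums either vanishes or separates,
    through [- r]. Coercivity supplies the nearest point, Caratheodory the fixed number of
    summands. *)
Theorem conic_farkas (c0 tau : 'rV[R]_M) :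
  (forall v, dotr v v <= dotr c0 (q v)) ->
  (exists V : 'I_M.+1 -> 'rV[R]_m, \sum_s q (V s) = tau) \/
  (exists c, (forall v, 0 <= dotr c (q v)) /\ dotr c tau < 0).
Proof.
move=> hc0; have [V0 minV0] := @conic_residual_min c0 tau M.+1 hc0.
have [V [VE [s0 Vs0]]] := conic_free_row V0.
rewrite /= -VE in minV0.
set r := tau - _ in minV0.
have [r0|r0] := eqVneq r 0; first by left; exists V; apply/esym/eqP; rewrite -subr_eq0 -/r r0.
right; exists (- r).
have rq v : dotr r (q v) <= 0.
  (* The vacant slot [s0] receives [Num.sqrt t *: v], which adds [t *: q v] to the sum without using
     a further summand. *)
  apply: dotr_le0_of_min => t /andP[t0 _].
  have := minV0 (fun s => if s == s0 then Num.sqrt t *: v else V s).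
  suff -> : \sum_s q (if s == s0 then Num.sqrt t *: v else V s) =
            \sum_s q (V s) + t *: q v by rewrite opprD addrA.
  rewrite (bigD1 s0) //= eqxx qh sqr_sqrtr ?ltW // addrC; congr (_ + _).
  rewrite [RHS](bigD1 s0) //= Vs0 -[X in q X](scale0r 0) qh expr0n scale0r add0r.
  by apply: eq_bigr => s /negbTE ->.
split=> [v|]; first by rewrite dotrNl oppr_ge0.
(* Shrinking the whole sum by the factor [1 - t] is also admissible. It gives that [dotr r tau] is
   at least [dotr r r]. *)
have rs : dotr r (- \sum_s q (V s)) <= 0.
  apply: dotr_le0_of_min => t /andP[t0 t1].
  have := minV0 (fun s => Num.sqrt (1 - t) *: V s).
  suff -> : \sum_s q (Num.sqrt (1 - t) *: V s) = (1 - t) *: \sum_s q (V s).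
    by rewrite scalerBl scale1r scalerN opprK opprB addrA addrAC -/r.
  by rewrite scaler_sumr; apply: eq_bigr => s _; rewrite qh sqr_sqrtr ?subr_ge0.
rewrite dotrNl oppr_lt0.
have -> : tau = r + \sum_s q (V s) by rewrite subrK.
rewrite dotrDr ltr_pwDl //; last by rewrite -oppr_le0 -dotrNr.
by rewrite lt_neqAle dotr_ge0 andbT eq_sym; apply: contraNneq r0 => /dotr_eq0 ->.
Qed.

End Farkas.

(** * Hermitian forms *)

Local Open Scope sesquilinear_scope.

Section Adjoint.
Variable C : numClosedFieldType.

Lemma adjmxM m n p (X : 'M[C]_(m, n)) (Y : 'M_(n, p)) :
  (X *m Y)^t* = Y^t* *m X^t*.
Proof. by rewrite trmx_mul map_mxM. Qed.

Lemma adjmxD m n (X Y : 'M[C]_(m, n)) : (X + Y)^t* = X^t* + Y^t*.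
Proof. by rewrite linearD /= map_mxD. Qed.

Lemma adjmxB m n (X Y : 'M[C]_(m, n)) : (X - Y)^t* = X^t* - Y^t*.
Proof. by rewrite linearB /= map_mxB. Qed.

Lemma adjmxZ m n a (X : 'M[C]_(m, n)) : (a *: X)^t* = a^* *: X^t*.
Proof. by rewrite linearZ /= map_mxZ. Qed.

Lemma adjmx1 n : (1%:M : 'M[C]_n)^t* = 1%:M.
Proof. by rewrite trmx1 map_mx1. Qed.

Lemma adjmx0 m n : (0 : 'M[C]_(m, n))^t* = 0.
Proof. by rewrite trmx0 map_mx0. Qed.

Lemma adjmx_sum m n I r (P : pred I) (F : I -> 'M[C]_(m, n)) :
  (\sum_(i <- r | P i) F i)^t* = \sum_(i <- r | P i) (F i)^t*.
Proof. exact: (big_morph _ (@adjmxD m n) (adjmx0 m n)). Qed.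

Lemma mxtrace_adj n (X : 'M[C]_n) : \tr (X^t*) = (\tr X)^*.
Proof. by rewrite raddf_sum; apply: eq_bigr => i _; rewrite !mxE. Qed.

Lemma mxtrace_adjM m n (X Y : 'M[C]_(m, n)) :
  \tr (X^t* *m Y) = \sum_i \sum_j (X i j)^* * Y i j.
Proof.
rewrite exchange_big; apply: eq_bigr => j _; rewrite mxE.
by apply: eq_bigr => i _; rewrite !mxE.
Qed.

Lemma gram_trace_ge0 m n (X : 'M[C]_(m, n)) : 0 <= \tr (X^t* *m X).
Proof.
rewrite mxtrace_adjM; do 2![apply: sumr_ge0 => ? _].
by rewrite mulrC mul_conjC_ge0.
Qed.

Lemma gram_trace_eq0 m n (X : 'M[C]_(m, n)) : \tr (X^t* *m X) = 0 -> X = 0.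
Proof.
move/eqP; rewrite mxtrace_adjM pair_big /= psumr_eq0 => [/allP X0|[i j] _ /=].
  apply/matrixP => i j; have := X0 (i, j) (mem_index_enum _).
  by rewrite /= mulrC mul_conjC_eq0 mxE => /eqP.
by rewrite mulrC mul_conjC_ge0.
Qed.

(* Its trace is [<L_A(X) W, W>] for the tuple [X_j = S_j^T], with [W] in
   [C^a (x) C^D] viewed as an [a x D] matrix. *)
Definition pencil_form g a D (A : 'I_g -> 'M[C]_a) (S : 'I_g -> 'M[C]_D)
    (W : 'M[C]_(a, D)) : 'M[C]_D :=
  let Z := \sum_j W^t* *m A j *m W *m S j in W^t* *m W + Z + Z^t*.

Lemma pencil_form_adj g a D (A : 'I_g -> 'M[C]_a) (S : 'I_g -> 'M[C]_D) W :
  (pencil_form A S W)^t* = pencil_form A S W.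
Proof. by rewrite /pencil_form !adjmxD adjmxM !trmxCK addrAC. Qed.

Lemma hformZ g a D (A : 'I_g -> 'M[C]_a) (S : 'I_g -> 'M[C]_D) c W :
  pencil_form A S (c *: W) = `|c| ^+ 2 *: pencil_form A S W.
Proof.
have Zc : \sum_j (c *: W)^t* *m A j *m (c *: W) *m S j =
          `|c| ^+ 2 *: \sum_j W^t* *m A j *m W *m S j.
  rewrite scaler_sumr; apply: eq_bigr => j _.
  by rewrite adjmxZ -!scalemxAl -scalemxAr -!scalemxAl scalerA normCKC.
rewrite /pencil_form Zc !scalerDr adjmxZ -scalemxAl -scalemxAr scalerA -normCKC.
by rewrite adjmxZ rmorphXn /= (CrealP (normr_real c)).
Qed.

End Adjoint.

(** * Real coordinates and the Farkas lemma for pencil forms *)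

Section Realification.
Import numFieldNormedType.Exports.
Local Open Scope classical_set_scope.
Variables (R : realType).
Local Notation C := R[i].
Local Notation Rc := (@complex.Re R).
Local Notation Ic := (@complex.Im R).

Definition realify m n (X : 'M[C]_(m, n)) : 'rV[R]_(m * n + m * n) :=
  row_mx (mxvec (map_mx Rc X)) (mxvec (map_mx Ic X)).

Definition complexify m n (v : 'rV[R]_(m * n + m * n)) : 'M[C]_(m, n) :=
  \matrix_(i, j) Complex (vec_mx (lsubmx v) i j) (vec_mx (rsubmx v) i j).

Lemma complexifyK m n : cancel (@complexify m n) (@realify m n).
Proof.
move=> v; rewrite -[RHS]hsubmxK -[in RHS](vec_mxK (lsubmx v)).
rewrite -[in RHS](vec_mxK (rsubmx v)).
by congr (row_mx (mxvec _) (mxvec _)); apply/matrixP => i j; rewrite !mxE.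
Qed.

Lemma realifyK m n : cancel (@realify m n) (@complexify m n).
Proof.
move=> X; apply/matrixP => i j.
by rewrite /complexify /realify mxE row_mxKl row_mxKr !mxvecK !mxE; case: (X i j).
Qed.

Lemma realifyD m n : {morph @realify m n : X Y / X + Y}.
Proof.
move=> X Y; rewrite /realify.
have Dr : map_mx Rc (X + Y) = map_mx Rc X + map_mx Rc Y.
  by apply/matrixP => i j; rewrite !mxE; case: (X i j) (Y i j) => a b [c d].
have Di : map_mx Ic (X + Y) = map_mx Ic X + map_mx Ic Y.
  by apply/matrixP => i j; rewrite !mxE; case: (X i j) (Y i j) => a b [c d].
by rewrite Dr Di !linearD /= add_row_mx.
Qed.

Lemma realify0 m n : realify (0 : 'M[C]_(m, n)) = 0.
Proof. by apply: (addIr (realify 0)); rewrite -realifyD !add0r. Qed.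

Lemma realifyZ m n (t : R) (X : 'M[C]_(m, n)) :
  realify (Complex t 0 *: X) = t *: realify X.
Proof.
rewrite /realify.
have Zr : map_mx Rc (Complex t 0 *: X) = t *: map_mx Rc X.
  by apply/matrixP => i j; rewrite !mxE; case: (X i j) => a b /=; rewrite mul0r subr0.
have Zi : map_mx Ic (Complex t 0 *: X) = t *: map_mx Ic X.
  by apply/matrixP => i j; rewrite !mxE; case: (X i j) => a b /=; rewrite mul0r addr0.
by rewrite Zr Zi scale_row_mx !linearZ.
Qed.

Lemma ReD (x y : C) : Rc (x + y) = Rc x + Rc y.
Proof. by case: x y => a b [c d]. Qed.

Lemma Re_sum I r (P : pred I) (F : I -> C) :
  Rc (\sum_(i <- r | P i) F i) = \sum_(i <- r | P i) Rc (F i).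
Proof. exact: (big_morph _ ReD). Qed.

Lemma dotr_realify m n (X Y : 'M[C]_(m, n)) :
  dotr (realify X) (realify Y) = Rc (\tr (X^t* *m Y)).
Proof.
rewrite mxtrace_adjM pair_big Re_sum /dotr big_split_ord /=.
under eq_bigr do rewrite !row_mxEl.
under [X in _ + X]eq_bigr do rewrite !row_mxEr.
rewrite -big_split /= (reindex _ (curry_mxvec_bij _ _)) /=.
apply: eq_bigr => -[i j] _ /=.
rewrite !mxvecE !mxE; case: (X i j) (Y i j) => a b [c d] /=.
by rewrite mulNr opprK.
Qed.

(** Stated through real and imaginary parts, so that only the topology of the real numbers
    enters. *)
Definition ccontinuous (T : topologicalType) (f : T -> C) : Prop :=
  continuous (Rc \o f) /\ continuous (Ic \o f).

Lemma ccontinuous_cst (T : topologicalType) c : ccontinuous (fun _ : T => c).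
Proof. by split=> x; exact: cvg_cst. Qed.

Lemma ccontinuousD (T : topologicalType) (f h : T -> C) :
  ccontinuous f -> ccontinuous h -> ccontinuous (fun x => f x + h x).
Proof.
move=> [f1 f2] [h1 h2]; split=> x.
  have -> : Rc \o (fun x => f x + h x) = (fun x => Rc (f x) + Rc (h x)).
    by apply/funext => y /=; case: (f y) (h y) => a b [c d].
  exact: (cvgD (f1 x) (h1 x)).
have -> : Ic \o (fun x => f x + h x) = (fun x => Ic (f x) + Ic (h x)).
  by apply/funext => y /=; case: (f y) (h y) => a b [c d].
exact: (cvgD (f2 x) (h2 x)).
Qed.

Lemma ccontinuousM (T : topologicalType) (f h : T -> C) :
  ccontinuous f -> ccontinuous h -> ccontinuous (fun x => f x * h x).
Proof.
move=> [f1 f2] [h1 h2]; split=> x.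
  have -> : Rc \o (fun x => f x * h x) =
      (fun x => Rc (f x) * Rc (h x) - Ic (f x) * Ic (h x)).
    by apply/funext => y /=; case: (f y) (h y) => a b [c d].
  exact: (cvgB (cvgM (f1 x) (h1 x)) (cvgM (f2 x) (h2 x))).
have -> : Ic \o (fun x => f x * h x) =
    (fun x => Rc (f x) * Ic (h x) + Ic (f x) * Rc (h x)).
  by apply/funext => y /=; case: (f y) (h y) => a b [c d].
exact: (cvgD (cvgM (f1 x) (h2 x)) (cvgM (f2 x) (h1 x))).
Qed.

Lemma ccontinuous_conj (T : topologicalType) (f : T -> C) :
  ccontinuous f -> ccontinuous (fun x => (f x)^*).
Proof.
move=> [f1 f2]; split=> x.
  have -> : Rc \o (fun x => (f x)^*) = Rc \o f.
    by apply/funext => y /=; case: (f y).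
  exact: f1.
have -> : Ic \o (fun x => (f x)^*) = (fun x => - Ic (f x)).
  by apply/funext => y /=; case: (f y).
exact: (cvgN (f2 x)).
Qed.

Lemma ccontinuous_sum (T : topologicalType) I (r : seq I) (F : I -> T -> C) :
  (forall i, ccontinuous (F i)) -> ccontinuous (fun x => \sum_(i <- r) F i x).
Proof.
move=> Fc; elim: r => [|i r IHr].
  by under eq_fun do rewrite big_nil; exact: ccontinuous_cst.
by under eq_fun do rewrite big_cons; exact: ccontinuousD.
Qed.

Lemma ccontinuous_mulmx (T : topologicalType) m n p
    (F : T -> 'M[C]_(m, n)) (H : T -> 'M[C]_(n, p)) :
  (forall i j, ccontinuous (fun x => F x i j)) ->
  (forall i j, ccontinuous (fun x => H x i j)) ->
  forall i j, ccontinuous (fun x => (F x *m H x) i j).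
Proof.
move=> Fc Hc i j; under eq_fun do rewrite mxE.
by apply: ccontinuous_sum => k; exact: ccontinuousM.
Qed.

Lemma ccontinuous_adjmx (T : topologicalType) m n (F : T -> 'M[C]_(m, n)) :
  (forall i j, ccontinuous (fun x => F x i j)) ->
  forall i j, ccontinuous (fun x => (F x)^t* i j).
Proof.
by move=> Fc i j; under eq_fun do rewrite !mxE; exact: ccontinuous_conj.
Qed.

Lemma ccontinuous_complexify m n i j :
  ccontinuous (fun v => @complexify m n v i j).
Proof.
split=> v.
  have -> : Rc \o (fun v => @complexify m n v i j) =
            (fun v => v 0 (lshift _ (mxvec_index i j))).
    by apply/funext => w /=; rewrite !mxE.
  exact: coord_continuous.
have -> : Ic \o (fun v => @complexify m n v i j) =
          (fun v => v 0 (rshift _ (mxvec_index i j))).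
  by apply/funext => w /=; rewrite !mxE.
exact: coord_continuous.
Qed.

Lemma continuous_realify (T : topologicalType) m n (F : T -> 'M[C]_(m, n)) l :
  (forall i j, ccontinuous (fun x => F x i j)) ->
  continuous (fun x => realify (F x) 0 l).
Proof.
move=> Fc; rewrite /realify; case: (split_ordP l) => k ->.
  have [i [j ->]] : exists i j, k = mxvec_index i j by case/mxvec_indexP: k => i j; exists i, j.
  under eq_fun do rewrite row_mxEl mxvecE mxE.
  exact: (Fc i j).1.
have [i [j ->]] : exists i j, k = mxvec_index i j by case/mxvec_indexP: k => i j; exists i, j.
under eq_fun do rewrite row_mxEr mxvecE mxE.
exact: (Fc i j).2.
Qed.

(** The pencil form is homogeneous of degree 2 under real scalars and continuous in real
    coordinates, so the conic Farkas lemma applies with [G0] as the coercive functional. *)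
Theorem hermitian_farkas g a D (A : 'I_g -> 'M[C]_a) (S : 'I_g -> 'M[C]_D)
    (G0 T : 'M[C]_D) :
  T^t* = T ->
  (forall W, \tr (W^t* *m W) <= \tr (G0 *m pencil_form A S W)) ->
  (exists K (W : 'I_K -> 'M[C]_(a, D)), \sum_s pencil_form A S (W s) = T) \/
  (exists G : 'M[C]_D, [/\ G^t* = G, forall W, 0 <= \tr (G *m pencil_form A S W) &
                           \tr (G *m T) < 0]).
Proof.
move=> Th hG0; pose q v := realify (pencil_form A S (complexify v)).
have qc l : continuous (fun v => q v 0 l).
  apply: continuous_realify => i j; rewrite /pencil_form.
  have cW : forall i j, ccontinuous (fun v => @complexify a D v i j).
    exact: ccontinuous_complexify.
  have cWa := ccontinuous_adjmx cW.
  have cZ i' j' : ccontinuous (fun v : 'rV[R]_(a * D + a * D) =>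
     (\sum_k (complexify v)^t* *m A k *m complexify v *m S k) i' j').
    under eq_fun do rewrite summxE.
    apply: ccontinuous_sum => k; do 3?[apply: ccontinuous_mulmx => //];
      by move=> *; exact: ccontinuous_cst.
  have -> : (fun v => pencil_form A S (complexify v) i j) =
      (fun v => ((complexify v)^t* *m complexify v) i j +
       (\sum_k (complexify v)^t* *m A k *m complexify v *m S k) i j +
       ((\sum_k (complexify v)^t* *m A k *m complexify v *m S k) j i)^*).
    by apply/funext => v; rewrite /pencil_form mxE [X in X + _]mxE [X in _ + X]mxE [X in X^*]mxE.
  apply: ccontinuousD; last by apply: ccontinuous_conj; exact: cZ.
  by apply: ccontinuousD; [exact: ccontinuous_mulmx|exact: cZ].
have qh t v : q (t *: v) = t ^+ 2 *: q v.
  rewrite /q -[in LHS](complexifyK v) -realifyZ realifyK hformZ -realifyZ.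
  congr (realify (_ *: _)).
  rewrite normCK; apply/eqP; rewrite eq_complex /=.
  by rewrite !(mulr0, mul0r, oppr0, subr0, addr0) expr2 !eqxx.
have Re_le (x y : C) : x <= y -> Rc x <= Rc y by rewrite lecE => /andP[].
have hc0 v : dotr v v <= dotr (realify (G0^t*)) (q v).
  rewrite /q dotr_realify trmxCK -[in leLHS](complexifyK v) dotr_realify.
  exact/Re_le/hG0.
have [[V VT]|[c [c_ge0 cT]]] := conic_farkas qc qh (realify T) hc0.
  left; exists _, (fun s => complexify (V s)).
  apply: (can_inj (@realifyK _ _)).
  by rewrite (big_morph _ (@realifyD _ _) (@realify0 _ _)).
(* The separating functional is only real linear. On Hermitian matrices its double is the trace
   against the Hermitian matrix [Gc + Gc^t*]. *)
right; pose Gc := complexify c; exists (Gc + Gc^t*).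
have trG H : H^t* = H -> \tr ((Gc + Gc^t*) *m H) =
    Complex (2 * dotr c (realify H)) 0.
  move=> Hh; rewrite -[c](complexifyK c) dotr_realify -/Gc.
  rewrite mulmxDl mxtraceD.
  have -> : \tr (Gc *m H) = (\tr (Gc^t* *m H))^*.
    by rewrite -mxtrace_adj adjmxM trmxCK Hh mxtrace_mulC.
  case: (\tr _) => x y; apply/eqP; rewrite eq_complex /=.
  by rewrite addNr mulrDl mul1r !eqxx.
split.
- by rewrite adjmxD trmxCK addrC.
- move=> W; rewrite trG ?pencil_form_adj // lecE /= eqxx /= mulr_ge0 //.
  by have := c_ge0 (realify W); rewrite /q realifyK.
by rewrite trG // ltcE /= eqxx /= pmulr_rlt0.
Qed.

End Realification.

(** * Evaluation on tensor products *)

(** Diagonalize [G] by the spectral theorem and take square roots of its eigenvalues, which are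
    positive. *)
Lemma posdef_factor (C : numClosedFieldType) D (G : 'M[C]_D) :
  G^t* = G -> (forall x : 'cV_D, x != 0 -> 0 < (x^t* *m G *m x) 0 0) ->
  exists2 K, K \in unitmx & G = K *m K^t*.
Proof.
move=> Gh Gpos; set P := spectralmx G; set s := spectral_diag G.
have Pu : P \is unitarymx := spectral_unitarymx G.
have GE : G = P^t* *m diag_mx s *m P.
  rewrite -invmx_unitary //; apply/orthomx_spectralP/normalmxP.
  by rewrite Gh.
have s_gt0 i : 0 < s 0 i.
  have -> : s 0 i = (((row i P)^t*)^t* *m G *m (row i P)^t*) 0 0.
    have -> : s 0 i = (P *m G *m P^t*) i i.
      rewrite GE !mulmxA (unitarymxP Pu) mul1mx -mulmxA (unitarymxP Pu) mulmx1.
      by rewrite mxE eqxx mulr1n.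
    rewrite trmxCK -row_mul mxE [RHS]mxE; apply: eq_bigr => k _.
    by rewrite !mxE.
  apply: Gpos; apply: contraTneq (spectral_unit G) => Pi0.
  rewrite unitmxE unitfE negbK -/P; apply/eqP.
  have ri : row i P = 0 by rewrite -[LHS]trmxCK Pi0 adjmx0.
  by rewrite (expand_det_row _ i) big1 // => j _; have /rowP/(_ j) := ri;
    rewrite !mxE => ->; rewrite mul0r.
pose rs := \row_i sqrtC (s 0 i).
have rsE : diag_mx s = diag_mx rs *m (diag_mx rs)^t*.
  rewrite tr_diag_mx map_diag_mx mulmx_diag; congr diag_mx.
  apply/rowP => i; rewrite !mxE /= geC0_conj ?sqrtC_ge0 ?ltW //.
  by rewrite -expr2 sqrtCK.
exists (P^t* *m diag_mx rs).
  rewrite unitmx_mul -invmx_unitary // unitmx_inv spectral_unit /=.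
  rewrite unitmxE det_diag unitfE prodf_seq_neq0; apply/allP => i _ /=.
  by rewrite mxE sqrtC_eq0 gt_eqF.
by rewrite adjmxM trmxCK mulmxA -(mulmxA (P^t*)) -rsE.
Qed.

Section Tensor.
Variable K : comNzRingType.

(** Vectors of a tensor product are handled as matrices: the operator [A *t X] becomes [Z] going to
    [A *m Z *m X^T], whence the transposes of [X] throughout. *)
Definition tvec m n (Z : 'M[K]_(m, n)) : 'cV[K]_(m * n) :=
  \col_x Z (mxtens_unindex x).1 (mxtens_unindex x).2.

Definition untvec m n (v : 'cV[K]_(m * n)) : 'M[K]_(m, n) :=
  \matrix_(i, j) v (mxtens_index (i, j)) 0.

Lemma tvecK m n : cancel (@tvec m n) (@untvec m n).
Proof. by move=> Z; apply/matrixP => i j; rewrite !mxE mxtens_indexK. Qed.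

Lemma untvecK m n : cancel (@untvec m n) (@tvec m n).
Proof.
by move=> v; apply/colP => x; rewrite !mxE -surjective_pairing mxtens_unindexK.
Qed.

Lemma tvecD m n : {morph @tvec m n : Z Z' / Z + Z'}.
Proof. by move=> Z Z'; apply/colP => x; rewrite !mxE. Qed.

Lemma tvec0 m n : tvec (0 : 'M[K]_(m, n)) = 0.
Proof. by apply/colP => x; rewrite !mxE. Qed.

Lemma tvecN m n : {morph @tvec m n : Z / - Z}.
Proof. by move=> Z; apply/colP => x; rewrite !mxE. Qed.

Lemma mxtens_index_bij m n : bijective (@mxtens_index m n).
Proof. by exists (@mxtens_unindex m n); [exact: mxtens_indexK|exact: mxtens_unindexK]. Qed.

Lemma tensmx_tvec m m' n n' (A : 'M[K]_(m', m)) (X : 'M[K]_(n', n)) Z :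
  (A *t X) *m tvec Z = tvec (A *m Z *m X^T).
Proof.
apply/colP => x; case: (mxtens_indexP x) => i j.
rewrite mxE (reindex _ (onW_bij _ (mxtens_index_bij m n))) /=.
rewrite mxE mxtens_indexK /= mxE.
under [RHS]eq_bigr do rewrite mxE big_distrl.
rewrite exchange_big pair_bigA; apply: eq_bigr => -[k l] _ /=.
by rewrite tensmxE !mxE mxtens_indexK /= mulrAC.
Qed.

Lemma Lambda_sum_tvec g d n (A : 'I_g -> 'M[K]_d) (X : 'I_g -> 'M[K]_n) Z :
  (\sum_j A j *t X j) *m tvec Z = tvec (\sum_j A j *m Z *m (X j)^T).
Proof.
rewrite mulmx_suml (big_morph _ (@tvecD _ _) (tvec0 _ _)).
by apply: eq_bigr => j _; exact: tensmx_tvec.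
Qed.

Lemma tvec_row n (y : 'rV[K]_n) : tvec y = castmx (esym (mul1n n), erefl) y^T.
Proof.
apply/colP => x; case: (mxtens_indexP x) => i j.
rewrite mxE castmxE mxE mxtens_indexK /= ord1 cast_ord_id.
by congr (y _ _); apply: val_inj => /=; rewrite mul0n.
Qed.

Lemma mulmx_castl a b p (e : a = b) (M : 'M[K]_a) (v : 'M[K]_(b, p)) :
  castmx (e, e) M *m v = castmx (e, erefl) (M *m castmx (esym e, erefl) v).
Proof. by case: b / e v => v; rewrite !castmx_id. Qed.

End Tensor.

Lemma tvec_dot (C : numClosedFieldType) m n (Z Z' : 'M[C]_(m, n)) :
  ((tvec Z)^t* *m tvec Z') 0 0 = \tr (Z^t* *m Z').
Proof.
rewrite mxtrace_adjM mxE (reindex _ (onW_bij _ (mxtens_index_bij m n))) /=.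
rewrite pair_bigA; apply: eq_bigr => -[i j] _ /=.
by rewrite !mxE mxtens_indexK.
Qed.

Section Spectrahedra.
Variable R : realType.
Local Notation C := R[i].

Lemma LambdaE_tvec g d n (A : 'I_g -> 'M[C]_d) (X : 'I_g -> 'M[C]_n) Z :
  Lambda A X *m tvec Z = tvec (\sum_j A j *m Z *m (X j)^T).
Proof. exact: Lambda_sum_tvec. Qed.

Lemma free_spectrahedronP g d n (A : 'I_g -> 'M[C]_d) (X : 'I_g -> 'M[C]_n) :
  free_spectrahedron A X <->
  (forall W, 0 <= \tr (pencil_form A (fun j => (X j)^T) W)).
Proof.
have E W : ((tvec W)^t* *m monic_pencil A X *m tvec W) 0 0 =
           \tr (pencil_form A (fun j => (X j)^T) W).
  rewrite /monic_pencil /pencil_form !mulmxDr !mulmxDl mulmx1.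
  set Z := \sum_j _.
  have L : ((tvec W)^t* *m Lambda A X *m tvec W) 0 0 = \tr Z.
    rewrite -mulmxA LambdaE_tvec tvec_dot mulmx_sumr; congr (\tr _).
    by apply: eq_bigr => j _; rewrite !mulmxA.
  have -> : (tvec W)^t* *m (Lambda A X)^t* *m tvec W =
            ((tvec W)^t* *m Lambda A X *m tvec W)^t*.
    by rewrite !adjmxM trmxCK mulmxA.
  rewrite mxE [X in X + _]mxE tvec_dot L !mxtraceD mxtrace_adj -L.
  by congr (_ + _); rewrite mxE [X in Num.conj X]mxE.
split=> [AX W|AX v]; first by rewrite -E; exact: AX.
by rewrite -(untvecK v) E; exact: AX.
Qed.

(** The equation for [Z] is the state equation of the realization, with input [b] tensor [y]. Any
    exhibited solution thus gives the value of [r] without computing the inverse. *)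
Lemma fr_eval_solve g (r : free_rational R g) n (X : 'I_g -> 'M[C]_n)
    (y : 'rV[C]_n) (Z : 'M[C]_(fr_dim r, n)) :
  fr_regular r X ->
  Z - \sum_j fr_E r j *m Z *m (X j)^T = fr_b r *m y ->
  y *m (fr_eval r X)^T = (fr_c r)^t* *m Z.
Proof.
move=> reg ZE.
have solve : tvec Z = invmx (1%:M - Lambda (fr_E r) X) *m tvec (fr_b r *m y).
  by rewrite -ZE tvecD tvecN -LambdaE_tvec -{2}[tvec Z]mul1mx -mulmxBl mulKmx.
have h : ((fr_c r)^t* *t (1%:M : 'M_n)) *m invmx (1%:M - Lambda (fr_E r) X)
       *m (fr_b r *t 1%:M) *m tvec y = tvec ((fr_c r)^t* *m Z).
  by rewrite -!mulmxA !tensmx_tvec !trmx1 !mulmx1 -solve tensmx_tvec trmx1 mulmx1.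
rewrite !tvec_row in h.
apply: trmx_inj; rewrite trmx_mul trmxK /fr_eval.
by rewrite mulmx_castl h castmxKV.
Qed.

Lemma fr_eval_exists g (r : free_rational R g) n (X : 'I_g -> 'M[C]_n)
    (y : 'rV[C]_n) : fr_regular r X ->
  exists Z, Z - \sum_j fr_E r j *m Z *m (X j)^T = fr_b r *m y.
Proof.
move=> reg; exists (untvec (invmx (1%:M - Lambda (fr_E r) X) *m tvec (fr_b r *m y))).
apply: (can_inj (@tvecK _ _ _)); rewrite tvecD tvecN -LambdaE_tvec untvecK.
by rewrite -{1}[invmx _]mul1mx -mulmxA -mulmxBl mulKVmx.
Qed.

End Spectrahedra.

(** * Separating functionals and shifts *)

Section HermitianForms.
Variable C : numClosedFieldType.

(** Passes from a positive definite functional on pencil forms to the plain trace at a similar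
    tuple, that is, to a point that can be tested for membership in the spectrahedron. *)
Lemma trace_pencil_form_conj g a D (A : 'I_g -> 'M[C]_a) (S : 'I_g -> 'M[C]_D) K W :
  K \in unitmx ->
  \tr ((K *m K^t*) *m pencil_form A S W) =
  \tr (pencil_form A (fun j => invmx K *m S j *m K) (W *m K)).
Proof.
move=> Ku; rewrite -mulmxA mxtrace_mulC /pencil_form.
have -> : \sum_j (W *m K)^t* *m A j *m (W *m K) *m (invmx K *m S j *m K) =
          K^t* *m (\sum_j W^t* *m A j *m W *m S j) *m K.
  rewrite mulmx_sumr mulmx_suml; apply: eq_bigr => j _.
  by rewrite adjmxM !mulmxA mulmxK.
by rewrite !mulmxDr !mulmxDl adjmxM !adjmxM trmxCK !mulmxA.
Qed.

Lemma addC_conj_ge (z : C) : - (2 * `|z|) <= z + z^*.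
Proof.
have -> : z + z^* = 2 * 'Re z by rewrite ReE mulrC divfK // pnatr_eq0.
rewrite -mulrN ler_pM2l ?ltr0n // lerNl.
apply: le_trans (leif_normC_Re_Creal z).1.
by rewrite -normrN real_ler_norm // rpredN Creal_Re.
Qed.

Lemma norm_le_gram_trace m n (M : 'M[C]_(m, n)) i j i' j' :
  `|M i j| * `|M i' j'| <= \tr (M^t* *m M).
Proof.
have h k l : `|M k l| <= sqrtC (\tr (M^t* *m M)).
  rewrite -[leLHS]sqrCK // ler_sqrtC ?nnegrE ?exprn_ge0 ?gram_trace_ge0 //.
  rewrite mxtrace_adjM pair_bigA (bigD1 (k, l)) //= -normCKC lerDl.
  by apply: sumr_ge0 => -[k' l'] _; rewrite -normCKC exprn_ge0.
rewrite -[leRHS]sqrtCK expr2; apply: ler_pM; rewrite ?h //.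
Qed.

Lemma pencil_form_bound g a D (A : 'I_g -> 'M[C]_a) (S : 'I_g -> 'M[C]_D) :
  exists2 c : C, 0 <= c & forall M, 
    `|\tr (\sum_j M^t* *m A j *m M *m S j)| <= c * \tr (M^t* *m M).
Proof.
pose c j := \sum_i \sum_l \sum_k \sum_h `|A j i h| * `|S j k l|.
have c_ge0 j : 0 <= c j by do 4![apply: sumr_ge0 => ? _]; rewrite mulr_ge0.
exists (\sum_j c j) => [|M]; first exact: sumr_ge0.
rewrite raddf_sum mulr_suml; apply: le_trans (ler_norm_sum _ _ _) _.
apply: ler_sum => j _; rewrite /= -!mulmxA (mxtrace_adjM M (A j *m (M *m S j))) /c mulr_suml.
apply: le_trans (ler_norm_sum _ _ _) _.
apply: ler_sum => i _.
rewrite mulr_suml; apply: le_trans (ler_norm_sum _ _ _) _; apply: ler_sum => l _.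
rewrite mulmxA mxE mulr_sumr mulr_suml.
apply: le_trans (ler_norm_sum _ _ _) _; apply: ler_sum => k _.
rewrite mxE mulr_suml mulr_sumr mulr_suml.
apply: le_trans (ler_norm_sum _ _ _) _; apply: ler_sum => h _.
rewrite !normrM norm_conjC.
have -> : `|M i l| * (`|A j i h| * `|M h k| * `|S j k l|) =
  (`|A j i h| * `|S j k l|) * (`|M i l| * `|M h k|).
  by ring.
by apply: ler_wpM2l; rewrite ?mulr_ge0 ?norm_le_gram_trace.
Qed.

Lemma pencil_form_small g a D (A : 'I_g -> 'M[C]_a) (S : 'I_g -> 'M[C]_D) :
  exists2 t : C, 0 < t <= 1 & forall M,
    2^-1 * \tr (M^t* *m M) <= \tr (pencil_form A (fun j => t *: S j) M).
Proof.
have [c c0 hc] := pencil_form_bound A S.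
(* With this [t] one has [2 * (t * c) <= 2^-1], so the linear term and its adjoint together absorb
   at most half of the square. *)
pose t : C := (4 * c + 1)^-1.
have d0 : 0 < 4 * c + 1 by rewrite ltr_wpDl ?mulr_ge0 ?ler0n // ltr01.
have t0 : 0 < t by rewrite invr_gt0.
exists t => [|M]; first by rewrite t0 invf_le1 // lerDr mulr_ge0 // ler0n.
have ct : 2 * (t * c) <= 2^-1.
  rewrite -(ler_pM2l (ltr0n _ 2)) divff ?pnatr_eq0 //.
  have -> : 2 * (2 * (t * c)) = (4 * c) / (4 * c + 1) :> C.
    by rewrite -/t; ring.
  by rewrite ler_pdivrMr // mul1r lerDl ler01.
have tZ : \sum_j M^t* *m A j *m M *m (t *: S j) =
          t *: \sum_j M^t* *m A j *m M *m S j.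
  by rewrite scaler_sumr; apply: eq_bigr => j _; rewrite -scalemxAr.
rewrite /pencil_form tZ !mxtraceD mxtrace_adj -addrA.
set z := \tr (t *: _).
have zb : 2 * `|z| <= 2^-1 * \tr (M^t* *m M).
  rewrite /z mxtraceZ normrM (ger0_norm (ltW t0)).
  apply: (@le_trans _ _ (2 * (t * c) * \tr (M^t* *m M))).
    rewrite -!mulrA ler_pM2l ?ltr0n // ler_pM2l //; exact: hc.
  by rewrite ler_wpM2r ?gram_trace_ge0.
have h : - (2^-1 * \tr (M^t* *m M)) <= z + z^*.
  by apply: le_trans (addC_conj_ge z); rewrite lerN2.
apply: le_trans (lerD (lexx (\tr (M^t* *m M))) h).
by rewrite -{2}[\tr _]mul1r -mulrBl {2}(splitr 1) mul1r addrK.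
Qed.

(* [L_(slack A) = L_A (+) 1].  The extra summand makes the functionals that are
   nonnegative on the certificates positive semidefinite even when [D_A] is
   unbounded; boundedness is not known for [D_B]. *)
Definition slack g d (A : 'I_g -> 'M[C]_d) : 'I_g -> 'M[C]_(d + 1) :=
  fun j => block_mx (A j) 0 0 0.

Lemma pencil_form_slack g d D (A : 'I_g -> 'M[C]_d) (S : 'I_g -> 'M[C]_D) W V :
  pencil_form (slack A) S (col_mx W V) = pencil_form A S W + V^t* *m V.
Proof.
have E (X : 'M[C]_d) : (col_mx W V)^t* *m block_mx X 0 0 0 *m col_mx W V =
   W^t* *m X *m W.
  rewrite tr_col_mx map_row_mx -mulmxA mul_block_col mul_row_col.
  by rewrite !mul0mx !addr0 mulmx0 addr0 mulmxA.
rewrite /pencil_form; under eq_bigr do rewrite E.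
by rewrite tr_col_mx map_row_mx mul_row_col -!addrA; congr (_ + _); rewrite addrC addrA.
Qed.

Lemma pencil_form_block g a D e (A : 'I_g -> 'M[C]_a) (S : 'I_g -> 'M[C]_D) W
    (F F' : 'M[C]_(D, e)) :
  F^t* *m pencil_form A S W *m F' = (W *m F)^t* *m (W *m F') +
    \sum_j (W *m F)^t* *m (A j *m W) *m (S j *m F') +
    (\sum_j (W *m F')^t* *m (A j *m W) *m (S j *m F))^t*.
Proof.
have h (X Y : 'M[C]_(D, e)) : X^t* *m (\sum_j W^t* *m A j *m W *m S j) *m Y =
    \sum_j (W *m X)^t* *m (A j *m W) *m (S j *m Y).
  rewrite mulmx_sumr mulmx_suml; apply: eq_bigr => j _.
  by rewrite adjmxM !mulmxA.
rewrite /pencil_form !mulmxDr !mulmxDl (h F F') -(h F' F) !adjmxM trmxCK.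
by congr (_ + _ + _); rewrite !mulmxA.
Qed.

Lemma gram_expand a e (X Y X' Y' : 'M[C]_(a, e)) :
  (X + Y)^t* *m (X' + Y') - Y^t* *m Y' = X^t* *m X' + X^t* *m Y' + (X'^t* *m Y)^t*.
Proof.
rewrite !adjmxD !mulmxDl !mulmxDr adjmxM trmxCK -!addrA.
by rewrite subrr addr0.
Qed.

(* Coefficient of [x_j w] in [(1 + Lambda_A(x)) W(x)]. *)
Definition pencil_coef g d e (A : 'I_g -> 'M[C]_d) (W : seq 'I_g -> 'M[C]_(d, e)) j w :=
  W (j :: w) + A j *m W w.

(** Compressing the identity between the blocks [F v] and [F w], each [S j] strips the letter [j].
    The linear terms become the cross terms in a product of two [pencil_coef]; the product of the
    two [A] terms is missing and is added on the right to complete the square. *)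
Lemma pencil_form_blocks g a D e N K (A : 'I_g -> 'M[C]_a) (S : 'I_g -> 'M[C]_D)
    (F : seq 'I_g -> 'M[C]_(D, e)) (W : 'I_K -> 'M[C]_(a, D)) T :
  (forall j, S j *m F [::] = 0) ->
  (forall j k w, (size w < N)%N -> S j *m F (k :: w) = (j == k)%:R *: F w) ->
  \sum_s pencil_form A S (W s) = T ->
  let G s := pencil_coef A (fun w => W s *m F w) in
  [/\ \sum_s (W s *m F [::])^t* *m (W s *m F [::]) = (F [::])^t* *m T *m F [::],
      forall j w, (size w < N)%N ->
        \sum_s (W s *m F [::])^t* *m G s j w = (F [::])^t* *m T *m F (j :: w) &
      forall i v j w, (size v < N)%N -> (size w < N)%N ->
        \sum_s (G s i v)^t* *m G s j w = (F (i :: v))^t* *m T *m F (j :: w) +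
        \sum_s (A i *m (W s *m F v))^t* *m (A j *m (W s *m F w))].
Proof.
move=> F0 FS WT G.
have Th v w : (F v)^t* *m T *m F w =
    \sum_s (F v)^t* *m pencil_form A S (W s) *m F w.
  by rewrite -WT mulmx_sumr mulmx_suml.
have sum0 (H : 'I_g -> 'M[C]_(e, D)) : \sum_j H j *m (S j *m F [::]) = 0.
  by apply: big1 => j _; rewrite F0 mulmx0.
have sumS w (H : 'I_g -> 'M[C]_(e, D)) k : (size w < N)%N ->
    \sum_j H j *m (S j *m F (k :: w)) = H k *m F w.
  move=> hw; rewrite (bigD1 k) //= FS // eqxx scale1r.
  rewrite big1 ?addr0 // => j jk.
  by rewrite FS // (negbTE jk) scale0r mulmx0.
split=> [|j w hw|i v j w hv hw].
- by rewrite Th; apply: eq_bigr => s _; rewrite pencil_form_block !sum0 adjmx0 !addr0.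
- rewrite Th; apply: eq_bigr => s _; rewrite pencil_form_block sum0 adjmx0 addr0 sumS //.
  by rewrite /G /pencil_coef mulmxDr !mulmxA.
apply/eqP; rewrite -subr_eq -sumrB; apply/eqP; rewrite Th.
apply: eq_bigr => s _; rewrite pencil_form_block !sumS // /G /pencil_coef gram_expand.
by rewrite -!mulmxA.
Qed.

(** A separating [G] may be singular. A small multiple of the coercive functional makes it positive
    definite, hence factorable, and does not spoil the strict inequality at [T]. *)
Lemma separating_factor g d D (A : 'I_g -> 'M[C]_d) (S : 'I_g -> 'M[C]_D)
    (K0 G T : 'M[C]_D) (c : C) :
  K0 \in unitmx -> 0 < c -> G^t* = G -> T^t* = T ->
  (forall W, \tr (W^t* *m W) <=
             \tr ((c *: (K0 *m K0^t*)) *m pencil_form (slack A) S W)) ->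
  (forall W, 0 <= \tr (G *m pencil_form (slack A) S W)) -> \tr (G *m T) < 0 ->
  exists2 K, K \in unitmx &
    (forall W, 0 <= \tr (K *m K^t* *m pencil_form A S W)) /\ \tr (K *m K^t* *m T) < 0.
Proof.
move=> K0u c0 Gh Th hc Gpos GT.
set G0 := c *: (K0 *m K0^t*) in hc.
pose b : C := `|\tr (G0 *m T)|.
(* The perturbation changes the trace against [T] by at most [eps * b], which is less than half of
   the gap; [b + 1] avoids division by zero. *)
pose eps := - \tr (G *m T) / (2 * (b + 1)).
have b0 : 0 < 2 * (b + 1) by rewrite mulr_gt0 ?ltr0n // ltr_wpDl ?normr_ge0 ?ltr01.
have eps0 : 0 < eps by rewrite divr_gt0 // oppr_gt0.
pose G' := G + eps *: G0.
have G0h : G0^t* = G0.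
  by rewrite /G0 adjmxZ (CrealP (gtr0_real c0)) adjmxM trmxCK.
have G'h : G'^t* = G' by rewrite /G' adjmxD adjmxZ Gh G0h (CrealP (gtr0_real eps0)).
have G'T : \tr (G' *m T) < 0.
  have bT : \tr (G0 *m T) <= b.
    apply: real_ler_norm; apply/CrealP; rewrite -mxtrace_adj adjmxM G0h.
    by rewrite Th mxtrace_mulC.
  rewrite /G' mulmxDl -scalemxAl mxtraceD mxtraceZ.
  apply: le_lt_trans (lerD (lexx _) (ler_wpM2l (ltW eps0) bT)) _.
  rewrite -ltrBrDl sub0r /eps mulrAC ltr_pdivrMr // ltr_pM2l ?oppr_gt0 //.
  have -> : 2 * (b + 1) = b + (b + 2) by ring.
  by rewrite ltrDl ltr_wpDl ?normr_ge0 ?ltr0n.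
have G'pos (x : 'cV[C]_D) : x != 0 -> 0 < (x^t* *m G' *m x) 0 0.
  move=> x0; rewrite /G' mulmxDr mulmxDl mxE ltr_wpDl //.
    (* On the slack coordinate alone the pencil form is [x *m x^t*], so [G] is positive
       semidefinite. *)
    have := Gpos (col_mx 0 (x^t*)); rewrite pencil_form_slack /pencil_form !mulmx0.
    rewrite big1 => [|j _]; last by rewrite mulmx0 mul0mx.
    rewrite adjmx0 !add0r trmxCK mulmxA mxtrace_mulC mulmxA.
    by rewrite /mxtrace big_ord1.
  have -> : x^t* *m (eps *: G0) *m x = (eps * c) *: ((K0^t* *m x)^t* *m (K0^t* *m x)).
    by rewrite adjmxM trmxCK /G0 scalerA -scalemxAr -scalemxAl !mulmxA.
  rewrite mxE; apply: mulr_gt0; first exact: mulr_gt0.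
  suff : 0 < \tr ((K0^t* *m x)^t* *m (K0^t* *m x)) by rewrite /mxtrace big_ord1.
  rewrite lt_neqAle gram_trace_ge0 andbT eq_sym.
  apply: contraNneq x0 => /gram_trace_eq0 Kx.
  have K0u' : K0^t* \in unitmx by rewrite map_unitmx unitmx_tr.
  by rewrite -(mulKmx K0u' x) Kx mulmx0.
have [K Ku GE] := posdef_factor G'h G'pos.
exists K => //; rewrite -GE; split=> // W.
have -> : pencil_form A S W = pencil_form (slack A) S (col_mx W 0).
  by rewrite pencil_form_slack adjmx0 mul0mx addr0.
rewrite /G' mulmxDl mxtraceD addr_ge0 // -scalemxAl mxtraceZ mulr_ge0 ?(ltW eps0) //.
exact: le_trans (gram_trace_ge0 _) (hc _).
Qed.

End HermitianForms.

(** * Truncated shifts on words *)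

Section Shift.
Variables (C : numClosedFieldType) (g N e : nat).

Local Notation idx := (N.-bseq 'I_g * 'I_e)%type.
Local Notation D := #|{: idx}|.

(* The basis vectors are the pairs of a word of length at most [N] and a
   coordinate in [C^e]. *)
Definition idx_word (x : 'I_D) : seq 'I_g := (enum_val x).1.
Definition idx_row (x : 'I_D) : 'I_e := (enum_val x).2.

Lemma size_idx_word x : (size (idx_word x) <= N)%N.
Proof. exact: size_bseq. Qed.

Lemma idx_exists w (hw : (size w <= N)%N) p : exists x, idx_word x = w /\ idx_row x = p.
Proof.
exists (enum_rank ((Bseq hw, p) : idx)).
by rewrite /idx_word /idx_row enum_rankK.
Qed.

Lemma idx_inj x y : idx_word x = idx_word y -> idx_row x = idx_row y -> x = y.
Proof.
move=> h1 h2; apply: enum_val_inj; move: h1 h2; rewrite /idx_word /idx_row.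
by case: (enum_val x) (enum_val y) => a b [c d] /= /val_inj -> ->.
Qed.

(** The block row with the scalar block [c w] at the word [w]. For an indicator function its adjoint
    embeds the component of that word. *)
Definition word_coef (c : seq 'I_g -> C) : 'M[C]_(e, D) :=
  \matrix_(p, x) (c (idx_word x) *+ (idx_row x == p)).

Definition word_block (w : seq 'I_g) := word_coef (fun v => (v == w)%:R).

(** A backward shift: it removes a leading letter [j] and kills the words that do not begin with
    [j]. *)
Definition shift (j : 'I_g) : 'M[C]_D :=
  \matrix_(x, y) ((idx_word y == j :: idx_word x) && (idx_row y == idx_row x))%:R.

Lemma sum_word_coef (F : 'I_D -> C) w (hw : (size w <= N)%N) p :
  exists2 x, idx_word x = w /\ idx_row x = p &
  \sum_y ((y == x)%:R * F y) = F x.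
Proof.
have [x xE] := idx_exists hw p; exists x => //.
rewrite (bigD1 x) //= eqxx mul1r big1 ?addr0 // => y /negbTE ->.
by rewrite mul0r.
Qed.

Lemma eq_idx x y : (x == y) = (idx_word x == idx_word y) && (idx_row x == idx_row y).
Proof.
apply/eqP/andP => [->|[/eqP h1 /eqP h2]]; first by rewrite !eqxx.
exact: idx_inj.
Qed.

Lemma word_coef_block c w : (size w <= N)%N ->
  word_coef c *m (word_block w)^t* = (c w)%:M.
Proof.
move=> hw; apply/matrixP => p q; rewrite !mxE.
have [x [xw xq] sx] := sum_word_coef (word_coef c p) hw q.
transitivity (word_coef c p x); last by rewrite mxE xw xq eq_sym.
rewrite -sx; apply: eq_bigr => y _; rewrite mulrC eq_idx xw xq !mxE.
by case: (idx_word y == w); case: (idx_row y == q); rewrite /= ?mulr0n ?mulr1n ?conjC0 ?conjC1.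
Qed.

Lemma shift_block j k w : (size w < N)%N ->
  shift j *m (word_block (k :: w))^t* = (j == k)%:R *: (word_block w)^t*.
Proof.
move=> hw; apply/matrixP => x p; rewrite !mxE.
have [y0 [yw yp] sy] := sum_word_coef (shift j x) (hw : (size (k :: w) <= N)%N) p.
transitivity (shift j x y0).
  rewrite -sy; apply: eq_bigr => y _; rewrite mulrC eq_idx yw yp !mxE.
  by case: (idx_word y == _); case: (idx_row y == p); rewrite /= ?mulr0n ?mulr1n ?conjC0 ?conjC1.
rewrite !mxE yw yp eqseq_cons /= (eq_sym k) (eq_sym w) (eq_sym p).
by case: (j == k); case: (idx_word x == w); case: (idx_row x == p);
  rewrite /= ?mulr0n ?mulr1n ?conjC0 ?conjC1 ?mulr0 ?mulr1 ?mul0r.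
Qed.

Lemma shift_block_nil j : shift j *m (word_block [::])^t* = 0.
Proof.
apply/matrixP => x p; rewrite !mxE big1 // => y _; rewrite !mxE.
case: (idx_word y =P [::]) => [->|_]; first by rewrite mul0r.
by rewrite mul0rn conjC0 mulr0.
Qed.

(** Since a shift lowers the length by one, conjugation by this grading multiplies every shift by
    [t]. *)
Definition grade_mx (t : C) : 'M[C]_D := diag_mx (\row_x t ^+ size (idx_word x)).

Lemma grade_mx_unit t : t != 0 -> grade_mx t \in unitmx.
Proof.
move=> t0; rewrite unitmxE det_diag unitfE prodf_seq_neq0; apply/allP => i _ /=.
by rewrite mxE expf_neq0.
Qed.

Lemma shift_grade t j : t != 0 ->
  invmx (grade_mx t) *m shift j *m grade_mx t = t *: shift j.
Proof.
move=> t0; apply: (can_inj (mulKmx (grade_mx_unit t0))).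
rewrite -!mulmxA mulKVmx ?grade_mx_unit // -scalemxAr.
apply/matrixP => x y; rewrite mul_mx_diag mul_diag_mx !mxE.
case: (idx_word y =P _) => [->|_]; last by rewrite /= mul0r mulr0 mulr0.
by case: (idx_row y == _); rewrite /= ?mul0r ?mulr0 ?mulr0 // mulr1 mul1r exprS.
Qed.

(** The pencil form is coercive at small multiples of the shifts, and grading makes the shifts
    small. In the constant, 2 undoes the loss of one half and the power of [t] the smallest weight,
    that of words of length [N]. *)
Lemma shift_coercive a (A : 'I_g -> 'M[C]_a) :
  exists2 K0, K0 \in unitmx & exists2 c, 0 < c & forall W,
    \tr (W^t* *m W) <= \tr ((c *: (K0 *m K0^t*)) *m pencil_form A shift W).
Proof.
have [t /andP[t0 t1] ht] := pencil_form_small A shift.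
have Ku : grade_mx t \in unitmx by rewrite grade_mx_unit ?gt_eqF.
exists (grade_mx t) => //; exists (2 * (t ^+ N) ^- 2).
  by rewrite mulr_gt0 ?ltr0n // invr_gt0 !exprn_gt0.
move=> W; rewrite -scalemxAl mxtraceZ trace_pencil_form_conj //.
have -> : pencil_form A (fun j => invmx (grade_mx t) *m shift j *m grade_mx t) =
          pencil_form A (fun j => t *: shift j).
  by congr pencil_form; apply/funext => j; rewrite shift_grade ?gt_eqF.
set M := W *m _.
have WM : (t ^+ N) ^+ 2 * \tr (W^t* *m W) <= \tr (M^t* *m M).
  rewrite !mxtrace_adjM mulr_sumr; apply: ler_sum => i _.
  rewrite mulr_sumr; apply: ler_sum => x _.
  rewrite -!normCKC /M mul_mx_diag !mxE normrM exprMn mulrC.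
  rewrite ler_wpM2l ?exprn_ge0 // normrX (ger0_norm (ltW t0)).
  have tk k : 0 <= t ^+ k by rewrite exprn_ge0 // ltW.
  by rewrite ler_sqr ?nnegrE // ler_wiXn2l ?(ltW t0) // size_idx_word.
have tN : 0 < t ^+ N ^+ 2 by rewrite !exprn_gt0.
rewrite -(ler_pM2l tN) mulrA (mulrCA _ 2) divff ?gt_eqF // mulr1.
apply: le_trans WM _.
by rewrite -ler_pdivrMl ?ltr0n //; exact: ht.
Qed.

End Shift.

(** * The certificate *)

Section Certificate.
Variable R : realType.
Local Notation C := R[i].

Definition map_coef g e (p : free_rational_map R g) (B : 'I_g -> 'M[C]_e) w :=
  \sum_i fr_coef (p i) w *: B i.

Lemma fr_state_exists g (r : free_rational R g) :
  exists ew : seq 'I_g -> 'cV[C]_(fr_dim r),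
  [/\ ew [::] = fr_b r, forall j w, ew (j :: w) = fr_E r j *m ew w &
      forall w, fr_coef r w = ((fr_c r)^t* *m ew w) 0 0].
Proof.
exists (fun w => foldr (fun j M => fr_E r j *m M) 1%:M w *m fr_b r).
by split=> [|j w|w]; rewrite /fr_coef /= ?mul1mx ?mulmxA.
Qed.

Section Target.
Variables (g e N : nat) (p : free_rational_map R g) (B : 'I_g -> 'M[C]_e).
Local Notation J := (@word_block C g N e).
Local Notation P := (@word_coef C g N e).
Local Notation D := #|{: (N.-bseq 'I_g * 'I_e)%type}|.

(* [target] is the matrix of coefficients of [L_B(p(x))], indexed by pairs of
   words. *)
Definition target_part :=
  (J [::])^t* *m \sum_i B i *m P (fr_coef (p i)).

Definition target := (J [::])^t* *m J [::] + target_part + target_part^t*.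

Lemma target_adj : target^t* = target.
Proof. by rewrite /target !adjmxD adjmxM !trmxCK addrAC. Qed.

Lemma word_block_ortho v w : (size w <= N)%N ->
  J v *m (J w)^t* = (v == w)%:R%:M.
Proof. by move=> hw; rewrite word_coef_block // eq_sym. Qed.

Lemma sum_word_coef_block w : (size w <= N)%N ->
  (\sum_i B i *m P (fr_coef (p i))) *m (J w)^t* = map_coef p B w.
Proof.
move=> hw; rewrite mulmx_suml; apply: eq_bigr => i _.
by rewrite -mulmxA word_coef_block // mul_mx_scalar.
Qed.

Lemma targetE v w : (size v <= N)%N -> (size w <= N)%N ->
  J v *m target *m (J w)^t* =
    ((v == [::]) && (w == [::]))%:R%:M + (v == [::])%:R *: map_coef p B w
    + (w == [::])%:R *: (map_coef p B v)^t*.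
Proof.
move=> hv hw; have J0 u : J u *m (J [::])^t* = (u == [::])%:R%:M.
  exact: word_block_ortho.
have J0' u : (size u <= N)%N -> J [::] *m (J u)^t* = (u == [::])%:R%:M.
  by move=> hu; rewrite word_block_ortho // eq_sym.
rewrite /target !mulmxDr !mulmxDl; congr (_ + _ + _).
- rewrite mulmxA -mulmxA J0 J0' // -scalar_mxM -natrM mulnb.
  by [].
- rewrite /target_part mulmxA J0 -mulmxA sum_word_coef_block //.
  by rewrite mul_scalar_mx.
rewrite /target_part adjmxM trmxCK -!mulmxA J0' // mulmxA.
by rewrite mul_mx_scalar -{1}[J v]trmxCK -adjmxM sum_word_coef_block.
Qed.

(** The state whose component at a word [w] is the vector [E_w b] solves the state equation, because
    a shift removes exactly the letter that the recursion adds. Evaluation at conjugated shifts thus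
    reads off all coefficients up to length [N]. *)
Lemma frm_eval_word_coef (K : 'M[C]_D) i :
  K \in unitmx ->
  let X := fun j => (invmx K *m @shift C g N e j *m K)^T in
  fr_regular (p i) X ->
  J [::] *m K *m (frm_eval p X i)^T = P (fr_coef (p i)) *m K.
Proof.
move=> Ku X reg; apply/row_matrixP => q; rewrite !row_mul.
have [ew [ew0 ewS ewc]] := fr_state_exists (p i).
pose V : 'M[C]_(fr_dim (p i), D) :=
  \matrix_(k, x) (ew (idx_word x) k 0 *+ (idx_row x == q)).
have VE k x : V k x = ew (idx_word x) k 0 *+ (idx_row x == q) by rewrite mxE.
have SE j x y : @shift C g N e j x y = ((idx_word y == j :: idx_word x) && (idx_row y == idx_row x))%:R.
  by rewrite mxE.
have solve : V *m K - \sum_j fr_E (p i) j *m (V *m K) *m (X j)^T =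
             fr_b (p i) *m (row q (J [::]) *m K).
  have -> : \sum_j fr_E (p i) j *m (V *m K) *m (X j)^T =
            (\sum_j fr_E (p i) j *m V *m @shift C g N e j) *m K.
    rewrite mulmx_suml; apply: eq_bigr => j _.
    by rewrite /X trmxK !mulmxA mulmxK.
  rewrite -mulmxBl mulmxA; congr (_ *m K); apply/matrixP => k x.
  rewrite mxE [X in _ + X]mxE summxE [RHS]mxE big_ord1 !mxE.
  case Ew : (idx_word x) => [|j w].
    rewrite ew0 eqxx big1 ?subr0 => [|j _].
      by case: (idx_row x == q); rewrite ?mulr1n ?mulr1 // !mulr0n mulr0.
    by rewrite mxE big1 // => y _; rewrite SE Ew /= mulr0.
  have [y [yw yq]] : exists y : 'I_D, idx_word y = w /\ idx_row y = idx_row x.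
    by apply: idx_exists; have := size_idx_word x; rewrite Ew => /ltnW.
  rewrite (bigD1 j) //= [X in _ - (_ + X)]big1 ?addr0 => [|j' j'j]; last first.
    rewrite mxE big1 // => z _; rewrite SE Ew eqseq_cons.
    by rewrite eq_sym (negbTE j'j) mulr0.
  rewrite mxE (bigD1 y) //= [X in _ - (_ + X)]big1 ?addr0 => [|z zy]; last first.
    rewrite SE Ew eqseq_cons eqxx /= -yw -yq andbC eq_sym andbC (eq_sym (idx_word y)) -eq_idx.
    by rewrite (negbTE zy) mulr0.
  rewrite SE Ew yw yq !eqxx mulr1 mul0rn mulr0 ewS mxE [X in _ - X]mxE.
  apply/eqP; rewrite subr_eq0; apply/eqP; rewrite -sumrMnl.
  by apply: eq_bigr => l _; rewrite VE yw yq mulrnAr.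
rewrite (fr_eval_solve reg solve) mulmxA; congr (_ *m K).
apply/rowP => x; rewrite mxE [RHS]mxE [RHS]mxE ewc.
rewrite [in RHS]mxE -sumrMnl; apply: eq_bigr => k _.
by rewrite VE mulrnAr.
Qed.

End Target.

Theorem pencil_certificate g d e (A : 'I_g -> 'M[C]_d) (B : 'I_g -> 'M[C]_e)
    (p : free_rational_map R g) N :
  frm_maps p A B -> vanishes_at_0 p ->
  exists K (W : 'I_K -> seq 'I_g -> 'M[C]_(d + 1, e)),
  let G s := pencil_coef (slack A) (W s) in
  [/\ \sum_s (W s [::])^t* *m W s [::] = 1%:M,
      forall j w, (size w < N)%N ->
        \sum_s (W s [::])^t* *m G s j w = map_coef p B (j :: w) &
      forall i v j w, (size v < N)%N -> (size w < N)%N ->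
        \sum_s (G s i v)^t* *m G s j w =
        \sum_s (slack A i *m W s v)^t* *m (slack A j *m W s w)].
Proof.
move=> pAB p0.
pose D := #|{: (N.-bseq 'I_g * 'I_e)%type}|.
pose J := @word_block C g N e; pose S := @shift C g N e.
pose T := @target g e N p B.
have [K0 K0u [c c0 hc]] := @shift_coercive C g N e _ (slack A).
have [[K [W WT]]|] := hermitian_farkas (target_adj N p B) hc.
  exists K, (fun s w => W s *m (J w)^t*) => G.
  have p00 : map_coef p B [::] = 0.
    by apply: big1 => i _; rewrite p0 scale0r.
  have := pencil_form_blocks (@shift_block_nil C g N e) (@shift_block C g N e) WT.
  case=> h1 h2 h3; split.
  - by rewrite h1 trmxCK targetE // p00 adjmx0 !scaler0 !addr0.
  - move=> j w hw; rewrite h2 // trmxCK targetE //=.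
    by rewrite scale0r scale1r addr0 raddf0 add0r.
  move=> i v j w hv hw; rewrite h3 // trmxCK targetE //=.
  by rewrite !scale0r !addr0 raddf0 add0r.
case=> G [Gh Gpos GT]; exfalso.
have [K Ku [Kpos KT]] := separating_factor K0u c0 Gh (target_adj N p B) hc Gpos GT.
pose X j := (invmx K *m S j *m K)^T.
have XA : free_spectrahedron A X.
  apply/free_spectrahedronP => W.
  have -> : (fun j => (X j)^T) = (fun j => invmx K *m S j *m K).
    by apply/funext => j; rewrite trmxK.
  by rewrite -(mulmxKV Ku W) -trace_pencil_form_conj.
have [reg /free_spectrahedronP pX] := pAB _ _ XA.
(* At the test vector [J [::] *m K] the form of the pencil of [B] at [p(X)] is the negative number
   found by separation, although [X] lies in the spectrahedron of [A]. *)
suff E : \tr (pencil_form B (fun j => (frm_eval p X j)^T) (J [::] *m K)) = \tr (K *m K^t* *m T).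
  by have := pX (J [::] *m K); rewrite E => /le_lt_trans/(_ KT); rewrite ltxx.
have -> : \tr (K *m K^t* *m T) = \tr (K^t* *m T *m K).
  by rewrite -mulmxA mxtrace_mulC.
congr (\tr _); rewrite /T /target /pencil_form /target_part.
have -> : \sum_j (J [::] *m K)^t* *m B j *m (J [::] *m K) *m (frm_eval p X j)^T =
   K^t* *m ((J [::])^t* *m \sum_i B i *m @word_coef C g N e (fr_coef (p i))) *m K.
  rewrite mulmx_sumr mulmx_sumr mulmx_suml; apply: eq_bigr => j _.
  rewrite -[LHS]mulmxA frm_eval_word_coef //; last exact: reg.
  by rewrite adjmxM !mulmxA.
by rewrite !mulmxDr !mulmxDl !adjmxM !trmxCK !mulmxA.
Qed.

End Certificate.

(** * Ball maps *)

Section HilbertSchmidt.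
Variable C : numClosedFieldType.

Definition nsq m n (X : 'M[C]_(m, n)) : C := \tr (X^t* *m X).

Lemma nsq_ge0 m n (X : 'M[C]_(m, n)) : 0 <= nsq X.
Proof. exact: gram_trace_ge0. Qed.

Lemma nsq_eq0 m n (X : 'M[C]_(m, n)) : nsq X = 0 -> X = 0.
Proof. exact: gram_trace_eq0. Qed.

Lemma nsqZ m n a (X : 'M[C]_(m, n)) : nsq (a *: X) = `|a| ^+ 2 * nsq X.
Proof.
by rewrite /nsq adjmxZ -scalemxAl -scalemxAr scalerA mxtraceZ mulrC normCKC mulrC.
Qed.

Lemma nsq_col_mx m m' n (X : 'M[C]_(m, n)) (Y : 'M[C]_(m', n)) :
  nsq (col_mx X Y) = nsq X + nsq Y.
Proof. by rewrite /nsq tr_col_mx map_row_mx mul_row_col mxtraceD. Qed.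

(* Bessel's identity for the isometry with blocks [W s]. *)
Lemma bessel_eq K a e n (W : 'I_K -> 'M[C]_(a, e)) (F : 'I_K -> 'M[C]_(a, n)) :
  \sum_s (W s)^t* *m W s = 1%:M ->
  let eta := \sum_s (W s)^t* *m F s in
  \sum_s (F s - W s *m eta)^t* *m (F s - W s *m eta) =
  \sum_s (F s)^t* *m F s - eta^t* *m eta.
Proof.
move=> W1 eta.
have E s : (F s - W s *m eta)^t* *m (F s - W s *m eta) =
    (F s)^t* *m F s - (F s)^t* *m W s *m eta
    - eta^t* *m ((W s)^t* *m F s) + eta^t* *m ((W s)^t* *m W s) *m eta.
  rewrite adjmxB mulmxBl !mulmxBr adjmxM opprB !mulmxA.
  by rewrite addrA addrAC.
under eq_bigr do rewrite E.
rewrite !big_split /= !sumrN -!mulmx_suml -!mulmx_sumr W1 mulmx1 -/eta.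
have -> : \sum_s (F s)^t* *m W s = eta^t*.
  by rewrite adjmx_sum; apply: eq_bigr => s _; rewrite adjmxM trmxCK.
by rewrite subrK.
Qed.

Lemma bessel_le K a e n (W : 'I_K -> 'M[C]_(a, e)) (F : 'I_K -> 'M[C]_(a, n)) :
  \sum_s (W s)^t* *m W s = 1%:M ->
  nsq (\sum_s (W s)^t* *m F s) <= \sum_s nsq (F s).
Proof.
move=> W1; rewrite -subr_ge0 /nsq -raddf_sum -raddfB /= -bessel_eq //.
by rewrite raddf_sum; apply: sumr_ge0 => s _; exact: nsq_ge0.
Qed.

(** Equality leaves a vanishing sum of squares of the residuals [F s - W s *m eta]. *)
Lemma bessel_tight K a e n (W : 'I_K -> 'M[C]_(a, e)) (F : 'I_K -> 'M[C]_(a, n)) :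
  \sum_s (W s)^t* *m W s = 1%:M ->
  let eta := \sum_s (W s)^t* *m F s in
  \sum_s (F s)^t* *m F s = eta^t* *m eta -> forall s, F s = W s *m eta.
Proof.
move=> W1 eta FE s; have /= := bessel_eq F W1; rewrite -/eta FE subrr.
move/(congr1 (@mxtrace _ _)); rewrite mxtrace0 raddf_sum /= => /eqP.
rewrite psumr_eq0 => [/allP/(_ s (mem_index_enum _))/eqP/nsq_eq0/eqP|s' _].
  by rewrite subr_eq0 => /eqP.
exact: nsq_ge0.
Qed.

Lemma psd_kernel n (M : 'M[C]_n) (v : 'cV[C]_n) :
  M^t* = M -> (forall w : 'cV[C]_n, 0 <= (w^t* *m M *m w) 0 0) ->
  (v^t* *m M *m v) 0 0 = 0 -> M *m v = 0.
Proof.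
move=> Mh Mpos vMv; apply: nsq_eq0; apply/eqP; rewrite eq_le nsq_ge0 andbT.
set a := nsq _; pose w := M *m v.
pose b := (w^t* *m M *m w) 0 0.
have b0 : 0 <= b by exact: Mpos.
have a0 : 0 <= a by exact: nsq_ge0.
have key (t : C) : 0 <= t -> 0 <= t * t * b - 2 * (t * a).
  move=> t0; have := Mpos (v - t *: w).
  have tr : t^* = t by apply/CrealP; exact: ger0_real.
  have wMv : (w^t* *m M *m v) 0 0 = a.
    by rewrite -mulmxA /a /nsq -/w /mxtrace big_ord1.
  have vMw : (v^t* *m M *m w) 0 0 = a.
    have -> : v^t* *m M = w^t* by rewrite /w adjmxM Mh.
    by rewrite /a /nsq -/w /mxtrace big_ord1.
  have -> : (v - t *: w)^t* *m M *m (v - t *: w) = v^t* *m M *m v -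
      t *: (v^t* *m M *m w) - t *: (w^t* *m M *m v) + (t * t) *: (w^t* *m M *m w).
    rewrite adjmxB adjmxZ tr !mulmxBl !mulmxBr -!scalemxAl -!scalemxAr scalerA.
    by rewrite opprB addrA addrAC.
  have entry (X Y Z T : 'M[C]_1) : (X - t *: Y - t *: Z + (t * t) *: T) 0 0 =
      X 0 0 - t * Y 0 0 - t * Z 0 0 + (t * t) * T 0 0 by rewrite !mxE.
  rewrite entry vMv wMv vMw -/b; congr (0 <= _); ring.
have b1 : 0 < b + 1 by rewrite ltr_wpDl ?ltr01.
(* Close to the minimizer [a / b] of the quadratic in [key], with [b + 1] to allow [b = 0]; the
   value is negative unless [a = 0]. *)
have := key (a / (b + 1)); rewrite divr_ge0 ?(ltW b1) // => /(_ isT).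
have -> : a / (b + 1) * (a / (b + 1)) * b - 2 * (a / (b + 1) * a) =
  - (a ^+ 2 * (b + 2) / (b + 1) ^+ 2) by field; rewrite gt_eqF.
rewrite oppr_ge0 => h; have [->//|an0] := eqVneq a 0.
have a_gt0 : 0 < a by rewrite lt_neqAle eq_sym an0.
suff /lt_le_trans/(_ h) : 0 < a ^+ 2 * (b + 2) / (b + 1) ^+ 2 by rewrite ltxx.
by rewrite divr_gt0 ?exprn_gt0 // mulr_gt0 ?exprn_gt0 // ltr_wpDl ?ltr0n.
Qed.

Lemma psd_kernel_spanned n (M : 'M[C]_n) (u v : 'cV[C]_n) :
  (kermx M^T == u^T)%MS -> M *m v = 0 -> exists c, v = c *: u.
Proof.
move=> /andP[h _] Mv.
have : (v^T <= u^T)%MS.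
  by apply: submx_trans h; apply/sub_kermxP; rewrite -trmx_mul Mv trmx0.
by case/sub_rVP => c cE; exists c; apply: trmx_inj; rewrite cE linearZ.
Qed.

Lemma kernel_generator n (M : 'M[C]_n) (u : 'cV[C]_n) :
  (kermx M^T == u^T)%MS -> M *m u = 0.
Proof.
move=> /andP[_ h]; have /sub_kermxP := h.
by rewrite -trmx_mul => /(congr1 trmx); rewrite trmxK trmx0.
Qed.

Lemma basis_family_unit d (u : 'I_d -> 'cV[C]_d) :
  basis_of fullv [seq u i | i : 'I_d] -> \matrix_k (u k)^T \in unitmx.
Proof.
move=> /basis_free fr; rewrite -row_free_unit; apply: inj_row_free => w.
have -> : w *m (\matrix_k (u k)^T) = (\sum_k w 0 k *: u k)^T.
  rewrite mulmx_sum_row linear_sum; apply: eq_bigr => k _.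
  by rewrite rowK linearZ.
move/(congr1 trmx); rewrite trmxK trmx0 => w0; apply/rowP => k.
have /freeP := (fr : free (map_tuple u (ord_tuple d))).
move/(_ (fun k => w 0 k)); rewrite mxE; apply.
by rewrite -[RHS]w0; apply: eq_bigr => i _; rewrite -tnth_nth tnth_map tnth_ord_tuple.
Qed.

(** Without the index [i] the relation is one among [d] vectors that form a basis. A nontrivial
    relation therefore has no zero coefficient. *)
Lemma hyperbasis_relation d (u : 'I_d.+1 -> 'cV[C]_d) (b : 'I_d.+1 -> C) i :
  (forall i : 'I_d.+1, basis_of fullv [seq u (lift i k) | k : 'I_d]) ->
  \sum_j b j *: u j = 0 -> b i = 0 -> forall j, b j = 0.
Proof.
move=> hu; rewrite (bigD1_ord i) //= => bu bi j.
move: bu; rewrite bi scale0r add0r => bu.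
have [k ->|->//] := unliftP i j.
have Uu := basis_family_unit (hu i).
pose w := \row_k b (lift i k).
have : w *m (\matrix_k (u (lift i k))^T) = 0.
  rewrite mulmx_sum_row -[RHS]trmx0 -bu linear_sum; apply: eq_bigr => l _.
  by rewrite rowK linearZ mxE.
by move/(canRL (mulmxK Uu)); rewrite mul0mx => /rowP/(_ k); rewrite !mxE.
Qed.

(** Apply [Z] to a nontrivial relation and subtract the first eigenvalue times that relation. The
    new relation has coefficient 0 at the first index, hence is trivial, and all eigenvalues
    agree. *)
Lemma hyperbasis_scalar d (u : 'I_d.+1 -> 'cV[C]_d) (Z : 'M[C]_d) :
  (forall i : 'I_d.+1, basis_of fullv [seq u (lift i k) | k : 'I_d]) ->
  (forall i, exists c, Z *m u i = c *: u i) -> exists c, Z = c%:M.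
Proof.
move=> hu Zu; have [c cE] := fin_all_exists Zu.
pose Q := \matrix_j (u j)^T.
have : kermx Q != 0.
  by rewrite kermx_eq0 /row_free neq_ltn ltnS (rank_leq_col Q).
case/rowV0Pn => b /sub_kermxP bQ /rV0Pn[s bs].
have sumE (x : 'I_d.+1 -> C) : (\sum_j x j *: u j)^T = (\row_j x j) *m Q.
  rewrite mulmx_sum_row linear_sum; apply: eq_bigr => k _.
  by rewrite rowK linearZ mxE.
have bu : \sum_j b 0 j *: u j = 0.
  apply: trmx_inj; rewrite sumE trmx0 -[RHS]bQ; congr (_ *m _).
  by apply/rowP => j; rewrite mxE.
have b0 j : b 0 j != 0.
  by apply: contraNneq bs => /(hyperbasis_relation hu bu)/(_ s) ->.
exists (c 0); have cc : forall j, b 0 j * (c j - c 0) = 0.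
  apply: (@hyperbasis_relation _ u _ 0 hu); last by rewrite subrr mulr0.
  under eq_bigr do rewrite mulrBr scalerBl mulrC (mulrC _ (c 0)) -!scalerA.
  rewrite sumrB -scaler_sumr bu scaler0 subr0.
  transitivity (\sum_j Z *m (b 0 j *: u j)); last by rewrite -mulmx_sumr bu mulmx0.
  apply: eq_bigr => j _.
  by rewrite -scalemxAr cE scalerA mulrC -scalerA.
have cj j : c j = c 0.
  by have /eqP := cc j; rewrite mulf_eq0 (negbTE (b0 j)) subr_eq0 => /eqP.
have Uu := basis_family_unit (hu 0).
apply: trmx_inj; apply: (can_inj (mulKmx Uu)); apply/row_matrixP => k.
rewrite !row_mul rowK -!trmx_mul cE cj.
by rewrite mul_scalar_mx.
Qed.

Lemma isometry_of_nsq d (U : 'M[C]_d) :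
  (forall x : 'cV[C]_d, nsq (U *m x) = nsq x) -> U^t* *m U = 1%:M.
Proof.
move=> Uiso; apply/eqP; rewrite -subr_eq0; apply/eqP; set M := _ - _.
have M0 (x : 'cV[C]_d) : (x^t* *m M *m x) 0 0 = 0.
  have -> : (x^t* *m M *m x) 0 0 = \tr (x^t* *m M *m x).
    by rewrite /mxtrace big_ord1.
  rewrite /M mulmxBr mulmxBl mulmx1 raddfB /= !mulmxA -mulmxA -adjmxM.
  by rewrite -/(nsq _) -/(nsq _) Uiso subrr.
apply: trmx_inj; apply/row_matrixP => i; rewrite linear0 row0 -tr_col colE.
rewrite (@psd_kernel _ M) ?trmx0 //; first by rewrite /M adjmxB adjmxM trmxCK adjmx1.
by move=> w; rewrite M0.
Qed.

(** One nonzero scalar product makes some [V = Y s0] invertible; all [Y s] are then multiples of [V]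
    and all [Y' r] of its inverse. Contractivity in both directions, with total weight 1, leaves no
    slack, so [V] is a multiple of a unitary. *)
Lemma proportional_unitary d K K' (Y : 'I_K -> 'M[C]_d) (Y' : 'I_K' -> 'M[C]_d)
    (c : 'I_K -> 'I_K' -> C) :
  (0 < d)%N ->
  (forall eta : 'cV[C]_d, \sum_s nsq (Y s *m eta) <= nsq eta) ->
  (forall eta : 'cV[C]_d, \sum_r nsq (Y' r *m eta) <= nsq eta) ->
  (forall s r, Y s *m Y' r = (c s r)%:M) ->
  \sum_s \sum_r `|c s r| ^+ 2 = 1 ->
  exists U k k', [/\ U^t* *m U = 1%:M, forall s, Y s = k s *: U,
    forall r, Y' r = k' r *: U^t*, \sum_s `|k s| ^+ 2 = 1 &
    \sum_r `|k' r| ^+ 2 = 1].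
Proof.
move=> d0 Yc Y'c YY' c1.
have [s0 [r0 c0]] : exists s r, c s r != 0.
  apply: contrapT => h; move: c1; rewrite big1 => [/esym/eqP|s _].
    by rewrite oner_eq0.
  rewrite big1 // => r _; apply/eqP; rewrite expf_eq0 normr_eq0.
  by apply: contrapT => /negP csr; apply: h; exists s, r.
pose V := Y s0.
have Vu : V \in unitmx.
  suff /mulmx1_unit[] : V *m ((c s0 r0)^-1 *: Y' r0) = 1%:M by [].
  by rewrite -scalemxAr YY' scale_scalar_mx mulVf.
have Y'E r : Y' r = c s0 r *: invmx V.
  by rewrite -[LHS](mulKmx Vu) YY' mul_mx_scalar.
pose k s := c s r0 / c s0 r0.
have YE s : Y s = k s *: V.
  have := YY' s r0; rewrite Y'E -scalemxAr => /(congr1 (fun X => (c s0 r0)^-1 *: X *m V)).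
  rewrite scalerA mulVf // scale1r mulmxKV // => ->.
  by rewrite scale_scalar_mx mul_scalar_mx mulrC.
have ck s r : c s r = k s * c s0 r.
  have := YY' s r; rewrite YE Y'E -scalemxAl -scalemxAr mulmxV // scalerA.
  move/matrixP/(_ (Ordinal d0) (Ordinal d0)); rewrite !mxE eqxx mulr1 mulr1n.
  by move->.
pose kap := \sum_s `|k s| ^+ 2; pose kap' := \sum_r `|c s0 r| ^+ 2.
have kk : kap * kap' = 1.
  rewrite -c1 mulr_suml; apply: eq_bigr => s _; rewrite mulr_sumr.
  by apply: eq_bigr => r _; rewrite (ck s r) -exprMn -normrM.
have kap_ge0 : 0 <= kap by apply: sumr_ge0 => s _; rewrite exprn_ge0.
have kap_gt0 : 0 < kap.
  rewrite lt_neqAle kap_ge0 andbT eq_sym; apply/eqP => k0.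
  by move: kk; rewrite k0 mul0r => /esym/eqP; rewrite oner_eq0.
have VE (eta : 'cV[C]_d) : kap * nsq (V *m eta) = nsq eta.
  apply/eqP; rewrite eq_le; apply/andP; split.
    apply: le_trans (Yc eta); rewrite mulr_suml; apply: ler_sum => s _.
    by rewrite YE -scalemxAl nsqZ.
  rewrite -[leLHS]mul1r -kk -mulrA ler_pM2l //.
  apply: le_trans (Y'c (V *m eta)); rewrite mulr_suml; apply: ler_sum => r _.
  by rewrite Y'E -scalemxAl mulKmx // nsqZ.
pose q := sqrtC kap.
have q0 : 0 < q by rewrite sqrtC_gt0.
have qn0 : q != 0 by rewrite gt_eqF.
have qq : q * q = kap by rewrite -expr2 sqrtCK.
pose U := q *: V.
have UU : U^t* *m U = 1%:M.
  apply: isometry_of_nsq => x; rewrite -(VE x) /U -scalemxAl nsqZ.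
  by rewrite ger0_norm ?ltW // expr2 qq.
have UV : U^t* = q^-1 *: invmx V.
  have Uu : U \in unitmx by have [] := mulmx1_unit UU.
  rewrite -[LHS](mulmxK Uu) UU mul1mx /U invmxZ //.
exists U, (fun s => k s / q), (fun r => c s0 r * q); split=> //.
- by move=> s; rewrite /U scalerA divfK.
- by move=> r; rewrite UV scalerA mulfK // Y'E.
- under eq_bigr do rewrite normrM exprMn.
  rewrite -mulr_suml -/kap normfV (ger0_norm (ltW q0)) exprVn expr2 qq divff //.
  by rewrite gt_eqF.
under eq_bigr do rewrite normrM exprMn.
by rewrite -mulr_suml -/kap' (ger0_norm (ltW q0)) expr2 qq mulrC.
Qed.

(* Witnesses that [A_j |-> B_j] is completely contractive. *)
Definition ball_map g d e (A : 'I_g -> 'M[C]_d) (B : 'I_g -> 'M[C]_e) K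
    (Y : 'I_K -> 'M[C]_(d, e)) :=
  (forall n (eta : 'M[C]_(e, n)), \sum_s nsq (Y s *m eta) <= nsq eta) /\
  (forall n (xi : 'I_g -> 'M[C]_(e, n)),
     nsq (\sum_j B j *m xi j) <= \sum_s nsq (\sum_j A j *m (Y s *m xi j))).

Lemma slack_mul g d e (A : 'I_g -> 'M[C]_d) (W : 'M[C]_(d + 1, e)) j :
  slack A j *m W = col_mx (A j *m usubmx W) 0.
Proof.
by rewrite -{1}[W]vsubmxK /slack mul_block_col !mul0mx !addr0.
Qed.

Lemma nsq_sum_gram K a e g n (F : 'I_K -> 'I_g -> 'M[C]_(a, e))
    (xi : 'I_g -> 'M[C]_(e, n)) :
  \sum_s nsq (\sum_j F s j *m xi j) =
  \tr (\sum_i \sum_j (xi i)^t* *m (\sum_s (F s i)^t* *m F s j) *m xi j).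
Proof.
have E s : nsq (\sum_j F s j *m xi j) =
    \tr (\sum_i \sum_j (xi i)^t* *m ((F s i)^t* *m F s j) *m xi j).
  rewrite /nsq adjmx_sum mulmx_suml; congr (\tr _); apply: eq_bigr => i _.
  rewrite mulmx_sumr; apply: eq_bigr => j _.
  by rewrite adjmxM !mulmxA.
under eq_bigr do rewrite E.
rewrite -raddf_sum /=; congr (\tr _); rewrite exchange_big; apply: eq_bigr => i _ /=.
rewrite exchange_big; apply: eq_bigr => j _ /=.
by rewrite mulmx_sumr mulmx_suml.
Qed.

(** Dropping the slack row of the isometry leaves a contraction. The second inequality is Bessel's,
    followed by the Gram identity, in which the slack row of [slack A] contributes nothing. *)
Lemma certificate_ball_map g d e (A : 'I_g -> 'M[C]_d) (B : 'I_g -> 'M[C]_e) K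
    (W : 'I_K -> 'M[C]_(d + 1, e)) (G : 'I_K -> 'I_g -> 'M[C]_(d + 1, e)) :
  \sum_s (W s)^t* *m W s = 1%:M ->
  (forall j, \sum_s (W s)^t* *m G s j = B j) ->
  (forall i j, \sum_s (G s i)^t* *m G s j =
               \sum_s (slack A i *m W s)^t* *m (slack A j *m W s)) ->
  ball_map A B (fun s => usubmx (W s)).
Proof.
move=> W1 WG GG; split=> [n eta|n xi].
  have -> : nsq eta = \sum_s nsq (W s *m eta).
    have /= := nsq_sum_gram (fun s (_ : 'I_1) => W s) (fun _ => eta).
    under eq_bigr do rewrite big_ord1.
    by move=> ->; rewrite !big_ord1 W1 mulmx1.
  apply: ler_sum => s _; rewrite -{2}[W s]vsubmxK mul_col_mx nsq_col_mx.
  by rewrite lerDl nsq_ge0.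
have -> : \sum_j B j *m xi j = \sum_s (W s)^t* *m (\sum_j G s j *m xi j).
  under [RHS]eq_bigr do rewrite mulmx_sumr.
  rewrite exchange_big; apply: eq_bigr => j _ /=.
  by rewrite -WG mulmx_suml; apply: eq_bigr => s _; rewrite mulmxA.
apply: le_trans (bessel_le _ W1) _.
rewrite nsq_sum_gram.
under eq_bigr do under eq_bigr do rewrite GG.
rewrite -(nsq_sum_gram (fun s j => slack A j *m W s)); apply: ler_sum => s _.
under eq_bigr do rewrite slack_mul mul_col_mx mul0mx -mulmxA.
have -> : \sum_j col_mx (A j *m (usubmx (W s) *m xi j)) 0 =
   col_mx (\sum_j A j *m (usubmx (W s) *m xi j)) (0 : 'M_(1, n)).
  elim/big_rec2: _ => [|j x y _ ->]; first by rewrite col_mx0.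
  by rewrite add_col_mx addr0.
by rewrite nsq_col_mx /nsq mulmx0 mxtrace0 addr0.
Qed.

(* The inequalities [|u| = |T u| <= ... <= |u|] along the composite force
   equality in each of them. *)
Lemma ball_comp_eigen g d e (A : 'I_g -> 'M[C]_d) (B : 'I_g -> 'M[C]_e) K K'
    (Y : 'I_K -> 'M[C]_(d, e)) (Y' : 'I_K' -> 'M[C]_(e, d))
    (alpha : 'rV[C]_g) (u : 'cV[C]_d) :
  ball_map A B Y -> ball_map B A Y' ->
  let T := \sum_j alpha 0 j *: A j in
  let M := 1%:M - T^t* *m T in
  (forall w : 'cV[C]_d, 0 <= (w^t* *m M *m w) 0 0) ->
  (kermx M^T == u^T)%MS ->
  (forall s r, exists c, Y s *m Y' r *m u = c *: u) /\
  \sum_r \sum_s nsq (Y s *m Y' r *m u) = nsq u.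
Proof.
move=> [Yc AB] [Y'c BA] T M Mpos Mu.
have Tform (w : 'cV[C]_d) : (w^t* *m M *m w) 0 0 = nsq w - nsq (T *m w).
  have -> : (w^t* *m M *m w) 0 0 = \tr (w^t* *m M *m w).
    by rewrite /mxtrace big_ord1.
  by rewrite /M mulmxBr mulmxBl mulmx1 raddfB /= /nsq adjmxM !mulmxA.
have Tle (w : 'cV[C]_d) : nsq (T *m w) <= nsq w.
  by rewrite -subr_ge0 -Tform.
have Tu : nsq (T *m u) = nsq u.
  apply/eqP; rewrite eq_sym -subr_eq0 -Tform -mulmxA (kernel_generator Mu).
  by rewrite mulmx0 mxE.
have pt m (D : 'I_g -> 'M[C]_m) (x : 'cV[C]_m) :
    \sum_j D j *m (alpha 0 j *: x) = (\sum_j alpha 0 j *: D j) *m x.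
  by rewrite mulmx_suml; apply: eq_bigr => j _; rewrite -scalemxAr scalemxAl.
have c1 : nsq (T *m u) <= \sum_r nsq ((\sum_j alpha 0 j *: B j) *m (Y' r *m u)).
  rewrite -pt; apply: le_trans (BA _ _) _; apply: ler_sum => r _.
  by under eq_bigr do rewrite -scalemxAr; rewrite pt.
have c2 : \sum_r nsq ((\sum_j alpha 0 j *: B j) *m (Y' r *m u)) <=
          \sum_r \sum_s nsq (T *m (Y s *m Y' r *m u)).
  apply: ler_sum => r _; rewrite -pt; apply: le_trans (AB _ _) _.
  apply: ler_sum => s _; under eq_bigr do rewrite -scalemxAr mulmxA.
  by rewrite pt.
have c3 : \sum_r \sum_s nsq (T *m (Y s *m Y' r *m u)) <=
          \sum_r \sum_s nsq (Y s *m Y' r *m u).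
  by do 2![apply: ler_sum => ? _]; exact: Tle.
have c4 : \sum_r \sum_s nsq (Y s *m Y' r *m u) <= nsq u.
  apply: le_trans (Y'c _ u); apply: ler_sum => r _.
  by apply: le_trans (Yc _ _); apply: ler_sum => s _; rewrite mulmxA.
have e4 : \sum_r \sum_s nsq (Y s *m Y' r *m u) = nsq u.
  apply/eqP; rewrite eq_le c4 /= -[leLHS]Tu.
  exact: le_trans c1 (le_trans c2 c3).
split=> // s r.
have e3 : \sum_r \sum_s (nsq (Y s *m Y' r *m u) - nsq (T *m (Y s *m Y' r *m u))) = 0.
  under eq_bigr do rewrite sumrB; rewrite sumrB; apply/eqP; rewrite subr_eq0.
  rewrite eq_le c3 andbT e4 -[leLHS]Tu; exact: le_trans c1 c2.
have pos s' r' : 0 <= nsq (Y s' *m Y' r' *m u) - nsq (T *m (Y s' *m Y' r' *m u)).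
  by rewrite subr_ge0.
(* Equality holds term by term, so each image of [u] lies in the kernel of [M], which is spanned by
   [u]. *)
apply: (psd_kernel_spanned Mu); apply: psd_kernel => //.
  by rewrite /M adjmxB adjmxM trmxCK adjmx1.
rewrite Tform; move/eqP: e3; rewrite psumr_eq0 => [/allP/(_ r (mem_index_enum _))|r' _].
  by rewrite psumr_eq0 // => /allP/(_ s (mem_index_enum _))/eqP.
by apply: sumr_ge0 => s' _.
Qed.

End HilbertSchmidt.

(** * Rigidity on words *)

Section WordRigidity.
Variable C : numClosedFieldType.

Definition wordmx g d (S : 'I_g -> 'M[C]_d) (w : seq 'I_g) : 'M[C]_d :=
  foldr (fun j M => S j *m M) 1%:M w.

Lemma word_rigidity g d N K (A B : 'I_g -> 'M[C]_d) (b : seq 'I_g -> 'M[C]_d)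
    (W : 'I_K -> seq 'I_g -> 'M[C]_(d + 1, d)) (Q U : 'M[C]_d)
    (k : 'I_K -> C) (Rt : 'I_g -> 'M[C]_d) :
  let G s := pencil_coef (slack A) (W s) in
  let S j := (Q - 1%:M) *m A j in
  \sum_s (W s [::])^t* *m W s [::] = 1%:M ->
  (forall j w, (size w < N)%N -> \sum_s (W s [::])^t* *m G s j w = b (j :: w)) ->
  (forall i v j w, (size v < N)%N -> (size w < N)%N ->
     \sum_s (G s i v)^t* *m G s j w =
     \sum_s (slack A i *m W s v)^t* *m (slack A j *m W s w)) ->
  (forall j, b [:: j] = B j) ->
  (forall s, W s [::] = col_mx (k s *: U) 0) ->
  \sum_s `|k s| ^+ 2 = 1 ->
  U^t* *m U = 1%:M -> Q^t* *m Q = 1%:M ->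
  (forall j, Q *m A j = U *m B j *m U^t*) ->
  \sum_j A j *m Rt j = 1%:M ->
  forall w, (size w <= N)%N ->
  (forall s, W s w = col_mx (k s *: (wordmx S w *m U)) 0) /\
  (forall j, (size w < N)%N -> b (j :: w) = U^t* *m (Q *m (A j *m wordmx S w)) *m U).
Proof.
move=> G S h1 h2 h3 bB W0 k1 UU QQ QA AR.
have UU' : U *m U^t* = 1%:M by apply: mulmx1C.
have QQ' : Q *m Q^t* = 1%:M by apply: mulmx1C.
have BE j : B j = U^t* *m (Q *m A j) *m U.
  by rewrite QA !mulmxA UU mul1mx -mulmxA UU mulmx1.
have gram_k (X Y : 'M[C]_d) :
    \sum_s (col_mx (k s *: X) (0 : 'M_(1, d)))^t* *m col_mx (k s *: Y) 0 = X^t* *m Y.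
  rewrite -[RHS]scale1r -k1 scaler_suml; apply: eq_bigr => s _.
  rewrite tr_col_mx map_row_mx mul_row_col mulmx0 addr0.
  by rewrite adjmxZ -scalemxAl -scalemxAr scalerA -normCKC.
have slackE w : (forall s, W s w = col_mx (k s *: (wordmx S w *m U)) 0) ->
    forall j s, slack A j *m W s w = col_mx (k s *: (A j *m wordmx S w *m U)) 0.
  by move=> Ww j s; rewrite slack_mul Ww col_mxKu -scalemxAr mulmxA.
have bgram (H : 'M[C]_d) : (U^t* *m (Q *m H) *m U)^t* *m (U^t* *m (Q *m H) *m U) =
    (H *m U)^t* *m (H *m U).
  rewrite !adjmxM trmxCK !mulmxA -(mulmxA _ U (U^t*)) UU' mulmx1.
  by rewrite -(mulmxA _ (Q^t*) Q) QQ mulmx1.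
(* Once [W s w] and [b (j :: w)] are known, the Gram identity is the case of equality in Bessel's
   inequality and determines [G s j w]. *)
have tight j w : (size w < N)%N ->
    (forall s, W s w = col_mx (k s *: (wordmx S w *m U)) 0) ->
    b (j :: w) = U^t* *m (Q *m (A j *m wordmx S w)) *m U ->
    forall s, G s j w = W s [::] *m b (j :: w).
  move=> hw Ww bw s; rewrite -h2 //.
  apply: (bessel_tight (F := fun s => G s j w) h1); rewrite h3 // h2 //.
  by under eq_bigr do rewrite !slackE //; rewrite gram_k bw bgram.
have base j : b [:: j] = U^t* *m (Q *m (A j *m wordmx S [::])) *m U.
  by rewrite bB BE mulmx1.
have W0' s : W s [::] = col_mx (k s *: (wordmx S [::] *m U)) 0.
  by rewrite W0 mul1mx.
elim=> [|i w IHw] hw; first by split=> // j _; exact: base.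
have [Ww bw] := IHw (ltnW hw).
(* Subtracting [slack A i *m W s w] from [G s i w] turns [Q *m A i] into [(Q - 1%:M) *m A i], which
   is the new letter of [wordmx S]. *)
have Wiw s : W s (i :: w) = col_mx (k s *: (wordmx S (i :: w) *m U)) 0.
  have := tight i w hw Ww (bw i hw) s.
  rewrite /G /pencil_coef slackE // bw // W0 => /(canRL (addrK _)) ->.
  rewrite mul_col_mx mul0mx opp_col_mx add_col_mx oppr0 addr0 -scalemxAl -scalerBr.
  by rewrite !mulmxA UU' mul1mx /= /S !mulmxBl !mul1mx.
split=> // j hiw; have N0 : (0 < N)%N by case: (N) hiw.
set H := A j *m wordmx S (i :: w).
(* Pairing with the one-letter words, where [G] is known, gives the next coefficient up to a left
   factor [(A l)^t*]. The adjoint of the right inverse [Rt] cancels these factors jointly. *)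
have cross l : (A l)^t* *m (Q^t* *m (U *m b (j :: i :: w))) = (A l)^t* *m (H *m U).
  have := h3 l [::] j (i :: w) N0 hiw.
  under [X in _ = X -> _]eq_bigr do rewrite (slackE _ W0') (slackE _ Wiw).
  rewrite gram_k -/H.
  under eq_bigr do rewrite (tight l [::] N0 W0' (base l)) adjmxM -mulmxA.
  rewrite -mulmx_sumr h2 // base [wordmx S [::]]/= !mulmx1 !adjmxM trmxCK.
  rewrite -!mulmxA => /(congr1 (mulmx U)).
  by rewrite !(mulmxA U) UU' !mul1mx !mulmxA.
have RA : \sum_l (Rt l)^t* *m (A l)^t* = 1%:M.
  rewrite -[RHS]adjmx1 -AR adjmx_sum.
  by apply: eq_bigr => l _; rewrite adjmxM.
have QUb : Q^t* *m (U *m b (j :: i :: w)) = H *m U.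
  rewrite -[LHS]mul1mx -[RHS]mul1mx -RA !mulmx_suml; apply: eq_bigr => l _.
  by rewrite -(mulmxA _ _ (Q^t* *m _)) cross mulmxA.
by rewrite -(mulmxA _ (Q *m H)) -(mulmxA Q H) -QUb (mulmxA Q) QQ' mul1mx mulmxA UU mul1mx.
Qed.

(** Equal norms make the passage from [\sum_j A j *m xi j] to [\sum_j B' j *m xi j] a well-defined
    isometry, and the right inverse [Rt] makes it defined everywhere. *)
Lemma nsq_polar g d (A B : 'I_g -> 'M[C]_d) (U : 'M[C]_d) (Rt : 'I_g -> 'M[C]_d) :
  U^t* *m U = 1%:M -> \sum_j A j *m Rt j = 1%:M ->
  (forall n (xi : 'I_g -> 'M[C]_(d, n)),
     nsq (\sum_j B j *m xi j) = nsq (\sum_j A j *m (U *m xi j))) ->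
  exists2 Q, Q^t* *m Q = 1%:M & forall j, Q *m A j = U *m B j *m U^t*.
Proof.
move=> UU AR BA; have UU' : U *m U^t* = 1%:M by apply: mulmx1C.
have Unsq m n (V : 'M[C]_m) (X : 'M[C]_(m, n)) : V^t* *m V = 1%:M ->
    nsq (V *m X) = nsq X.
  by move=> VV; rewrite /nsq adjmxM !mulmxA -(mulmxA _ (V^t*)) VV mulmx1.
pose B' j := U *m B j *m U^t*.
have B'A n (xi : 'I_g -> 'M[C]_(d, n)) :
    nsq (\sum_j B' j *m xi j) = nsq (\sum_j A j *m xi j).
  have -> : \sum_j B' j *m xi j = U *m \sum_j B j *m (U^t* *m xi j).
    by rewrite mulmx_sumr; apply: eq_bigr => j _; rewrite !mulmxA.
  rewrite Unsq // BA; congr nsq; apply: eq_bigr => j _.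
  by rewrite (mulmxA U) UU' mul1mx.
pose Q := \sum_j B' j *m Rt j.
exists Q.
  apply: isometry_of_nsq => x; rewrite /Q mulmx_suml.
  under eq_bigr do rewrite -mulmxA.
  rewrite B'A; under eq_bigr do rewrite mulmxA.
  by rewrite -mulmx_suml AR mul1mx.
move=> i; apply/eqP; rewrite -/(B' i) -subr_eq0; apply/eqP; apply: nsq_eq0.
(* For these [xi] the combination of the [A j] vanishes, hence so does that of the [B' j], which is
   [Q *m A i - B' i]. *)
have sumB (D : 'I_g -> 'M[C]_d) :
    \sum_j D j *m (Rt j *m A i - (j == i)%:R *: 1%:M) =
    (\sum_j D j *m Rt j) *m A i - D i.
  under eq_bigr do rewrite mulmxBr mulmxA.
  rewrite sumrB -mulmx_suml; congr (_ - _); rewrite (bigD1 i) //= eqxx scale1r.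
  by rewrite mulmx1 big1 ?addr0 // => j /negbTE ->; rewrite scale0r mulmx0.
by rewrite -sumB B'A sumB AR mul1mx subrr /nsq mulmx0 mxtrace0.
Qed.

End WordRigidity.

(** * Consequences of sv-genericity *)

Section Generic.
Variable C : numClosedFieldType.

(** The adjoint of [u k] equals [(T k *m u k)^t* *m T k], a left combination of the [A j]. Stacking
    these rows gives an invertible matrix, as the [u k] form a basis. *)
Lemma joint_left_inverse g d (A : 'I_g -> 'M[C]_d) (al : 'I_d -> 'rV[C]_g)
    (u : 'I_d -> 'cV[C]_d) :
  basis_of fullv [seq u i | i : 'I_d] ->
  (forall k, let T := \sum_j al k 0 j *: A j in T^t* *m T *m u k = u k) ->
  exists L, \sum_j L j *m A j = 1%:M.
Proof.
move=> /basis_family_unit ub Tu.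
pose T k := \sum_j al k 0 j *: A j.
pose Q := map_mx Num.conj (\matrix_k (u k)^T).
have Qu : Q \in unitmx by rewrite map_unitmx.
pose P j := \matrix_k (al k 0 j *: (T k *m u k)^t*).
have QE : Q = \sum_j P j *m A j.
  apply/row_matrixP => k; rewrite linear_sum /= /Q -map_row rowK.
  rewrite -{1}(Tu k) -mulmxA adjmxM trmxCK -/(T k) {2}/T mulmx_sumr.
  by apply: eq_bigr => j _; rewrite row_mul rowK -scalemxAr scalemxAl.
exists (fun j => invmx Q *m P j).
under eq_bigr do rewrite -mulmxA.
by rewrite -mulmx_sumr -QE mulVmx.
Qed.

End Generic.

Section SvGeneric.
Variable R : realType.
Local Notation C := R[i].

Lemma gram_kernel_fixed d (T : 'M[C]_d) (u : 'cV[C]_d) :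
  kernel_spanned_by (1%:M - T^t* *m T) u -> T^t* *m T *m u = u.
Proof.
move/kernel_generator; rewrite mulmxBl mul1mx => /eqP.
by rewrite subr_eq0 => /eqP.
Qed.

Lemma sv_generic_left_inverse g d (A : 'I_g -> 'M[C]_d) :
  sv_generic A -> exists L, \sum_j L j *m A j = 1%:M.
Proof.
case=> alpha [_ [u [_ [hu ub _ _]]]].
apply: (joint_left_inverse (al := fun k => alpha (lift 0 k)) (ub 0)) => k.
by have [_ _ /gram_kernel_fixed] := hu (lift 0 k).
Qed.

Lemma sv_generic_right_inverse g d (A : 'I_g -> 'M[C]_d) :
  sv_generic A -> exists Rt, \sum_j A j *m Rt j = 1%:M.
Proof.
case=> _ [beta [_ [v [_ _ hv vb]]]].
(* A right inverse is the adjoint of a left inverse for the adjoint tuple, taken at the conjugates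
   of the points [beta]. *)
have [|L LA] := joint_left_inverse (A := fun j => (A j)^t*)
  (al := fun k => map_mx Num.conj (beta k)) vb.
  move=> k /=; set T := \sum_j _.
  have TE : T = (Lambda_pt A (beta k))^t*.
    rewrite /T /Lambda_pt adjmx_sum; apply: eq_bigr => j _.
    by rewrite adjmxZ mxE.
  apply: gram_kernel_fixed; rewrite TE trmxCK.
  by have [_] := hv k.
exists (fun j => (L j)^t*); rewrite -[RHS]adjmx1 -LA adjmx_sum.
by apply: eq_bigr => j _; rewrite adjmxM trmxCK.
Qed.

Lemma sv_generic_ball_comp g d e (A : 'I_g -> 'M[C]_d) (B : 'I_g -> 'M[C]_e)
    K K' (Y : 'I_K -> 'M[C]_(d, e)) (Y' : 'I_K' -> 'M[C]_(e, d)) :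
  sv_generic A -> ball_map A B Y -> ball_map B A Y' ->
  (0 < d)%N /\ exists c, (forall s r, Y s *m Y' r = (c s r)%:M) /\
    \sum_s \sum_r `|c s r| ^+ 2 = 1.
Proof.
case=> alpha [_ [u [_ [hu ub _ _]]]] AB BA.
have eig i : (forall s r, exists c, Y s *m Y' r *m u i = c *: u i) /\
  \sum_r \sum_s nsq (Y s *m Y' r *m u i) = nsq (u i).
  have [Mpsd _ Mu] := hu i.
  exact: (ball_comp_eigen (alpha := alpha i) AB BA Mpsd Mu).
(* The kernel has rank 1, so its generator is nonzero. This excludes [d = 0] and lets the norm
   identity at [u 0] normalize the scalars. *)
have u0 : u 0 != 0.
  have [_ rk /andP[ku _]] := hu 0; apply/eqP => u0.
  have /mxrankS := ku; rewrite rk u0 trmx0 mxrank0.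
  by [].
have d0 : (0 < d)%N.
  rewrite lt0n; apply: contraNneq u0 => d0.
  by apply/eqP/colP => i; have := ltn_ord i; rewrite {2}d0.
split=> //.
have h s r : exists c, Y s *m Y' r = c%:M.
  by apply: (hyperbasis_scalar ub) => i; have [] := eig i.
have [c cE] := fin_all_exists (fun s => fin_all_exists (h s)).
exists c; split=> //.
have nu : nsq (u 0) != 0 by apply: contraNneq u0 => /nsq_eq0 ->.
apply: (mulIf nu); rewrite mul1r -[RHS](eig 0).2 [RHS]exchange_big /= mulr_suml.
apply: eq_bigr => s _; rewrite mulr_suml; apply: eq_bigr => r _.
by rewrite cE mul_scalar_mx nsqZ.
Qed.

Lemma sv_generic_ball_dim g d e (A : 'I_g -> 'M[C]_d) (B : 'I_g -> 'M[C]_e)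
    K K' (Y : 'I_K -> 'M[C]_(d, e)) (Y' : 'I_K' -> 'M[C]_(e, d)) :
  sv_generic A -> ball_map A B Y -> ball_map B A Y' -> (d <= e)%N.
Proof.
move=> hA AB BA; have [_ [c [YY' c1]]] := sv_generic_ball_comp hA AB BA.
have [s [r c0]] : exists s r, c s r != 0.
  apply: contrapT => h; move: c1; rewrite big1 => [/esym/eqP|s _].
    by rewrite oner_eq0.
  rewrite big1 // => r _; apply/eqP; rewrite expf_eq0 normr_eq0.
  by apply: contrapT => /negP csr; apply: h; exists s, r.
have : Y s *m ((c s r)^-1 *: Y' r) = 1%:M.
  by rewrite -scalemxAr YY' scale_scalar_mx mulVf.
by move/mulmx1_min.
Qed.

(** When all products of two entries vanish, the Neumann series of the state stops after degree
    1. *)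
Lemma fr_eval_square_zero g (r : free_rational R g) n (X : 'I_g -> 'M[C]_n) :
  fr_regular r X -> (forall i j, X i *m X j = 0) ->
  fr_eval r X = (fr_coef r [::])%:M + \sum_j fr_coef r [:: j] *: X j.
Proof.
move=> reg XX; apply: trmx_inj; apply/row_matrixP => i; rewrite rowE.
set y := delta_mx 0 i; set b := fr_b r; set E := fr_E r.
have -> : y *m (fr_eval r X)^T =
    (fr_c r)^t* *m (b *m y + \sum_j E j *m b *m (y *m (X j)^T)).
  apply: fr_eval_solve => //.
  have -> : \sum_j E j *m (b *m y + \sum_k E k *m b *m (y *m (X k)^T)) *m (X j)^T
      = \sum_j E j *m b *m (y *m (X j)^T).
    apply: eq_bigr => j _; rewrite mulmxDr mulmxDl mulmx_sumr mulmx_suml.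
    rewrite big1 ?addr0 => [|k _]; first by rewrite !mulmxA.
    by rewrite -!mulmxA -trmx_mul XX trmx0 !mulmx0.
  by rewrite addrK.
have scal (w : 'cV[C]_(fr_dim r)) : (fr_c r)^t* *m w = (((fr_c r)^t* *m w) 0 0)%:M.
  exact: mx11_scalar.
rewrite mulmxDr mulmx_sumr rowE -/y linearD /= tr_scalar_mx linear_sum /= mulmxDr.
congr (_ + _).
  by rewrite mulmxA scal mul_scalar_mx mul_mx_scalar /fr_coef /= mulmx1.
rewrite mulmx_sumr; apply: eq_bigr => j _.
rewrite (mulmxA _ (E j *m b)) scal mul_scalar_mx linearZ /= -scalemxAr; congr (_ *: _).
by rewrite /fr_coef /= mulmx1 !mulmxA.
Qed.

(** At a small multiple of a square-zero matrix unit in the direction [k], the map [p] is the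
    identity; so [q] fixes this point, and its coefficients up to degree 1 are the entries of the
    equation. *)
Lemma inverse_coef g d e (A : 'I_g -> 'M[C]_d) (B : 'I_g -> 'M[C]_e)
    (p q : free_rational_map R g) :
  frm_maps p A B -> frm_maps q B A ->
  (forall n (X : 'I_g -> 'M[C]_n), free_spectrahedron A X ->
     frm_eval q (frm_eval p X) =1 X) ->
  vanishes_at_0 p -> derivative_at_0_is_id p ->
  vanishes_at_0 q /\ derivative_at_0_is_id q.
Proof.
move=> pAB qBA qp p0 p1.
suff h i k : fr_coef (q i) [::] = 0 /\ fr_coef (q i) [:: k] = (i == k)%:R.
  by split=> [i|i k]; [have [] := h i i|have [] := h i k].
pose E : 'M[C]_2 := delta_mx 0 1.
have EE : E *m E = 0 by rewrite mul_delta_mx_0.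
have [t /andP[t0 _] ht] := pencil_form_small A (fun j => (j == k)%:R *: E^T).
pose X j : 'M[C]_2 := ((j == k)%:R * t) *: E.
have XX i' j : X i' *m X j = 0.
  by rewrite /X -scalemxAl -scalemxAr EE !scaler0.
have XA : free_spectrahedron A X.
  apply/free_spectrahedronP => W.
  have -> : (fun j => (X j)^T) = (fun j => t *: ((j == k)%:R *: E^T)).
    by apply/funext => j; rewrite linearZ /= scalerA mulrC.
  apply: le_trans (ht W); rewrite mulr_ge0 ?gram_trace_ge0 //.
  by rewrite invr_ge0 ler0n.
have [pr pX] := pAB _ _ XA.
have pE : frm_eval p X = X.
  apply/funext => j; rewrite /frm_eval fr_eval_square_zero ?pr //.
  rewrite p0 raddf0 add0r (bigD1 j) //= p1 eqxx scale1r big1 ?addr0 //.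
  by move=> l lj; rewrite p1 eq_sym (negbTE lj) scale0r.
rewrite pE in pX.
have [qr _] := qBA _ _ pX.
have := qp _ _ XA i; rewrite pE /frm_eval fr_eval_square_zero ?qr //.
move/matrixP => h; split.
  have := h 0 0; rewrite !mxE summxE big1 => [|j _]; last by rewrite !mxE /= !mulr0.
  by rewrite /= mulr0 addr0.
have := h 0 1; rewrite !mxE summxE (bigD1 k) //= big1 => [|j /negbTE jk]; last first.
  by rewrite /X jk mul0r scale0r scaler0 mxE.
rewrite !mxE !eqxx /= mulr0n add0r addr0 !mulr1 mul1r.
by apply: mulIf; rewrite gt_eqF.
Qed.

Lemma map_coef1 g e (p : free_rational_map R g) (B : 'I_g -> 'M[C]_e) j :
  derivative_at_0_is_id p -> map_coef p B [:: j] = B j.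
Proof.
move=> p1; rewrite /map_coef (bigD1 j) //= p1 eqxx scale1r big1 ?addr0 //.
by move=> i /negbTE ij; rewrite p1 ij scale0r.
Qed.

Lemma map_ball_certificate g d e (A : 'I_g -> 'M[C]_d) (B : 'I_g -> 'M[C]_e) p :
  frm_maps p A B -> vanishes_at_0 p -> derivative_at_0_is_id p ->
  exists K (Y : 'I_K -> 'M[C]_(d, e)), ball_map A B Y.
Proof.
move=> pAB p0 p1; have [K [W [h1 h2 h3]]] := pencil_certificate 1 pAB p0.
exists K, (fun s => usubmx (W s [::])).
apply: (certificate_ball_map (G := fun s j => pencil_coef (slack A) (W s) j [::])) => //.
  by move=> j; rewrite h2 // map_coef1.
by move=> i j; rewrite h3.
Qed.

(** The certificate for [p] and the ball map of the inverse give [U], then [Q] from equality of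
    norms in both directions. Rigidity then applies to the certificate of the given length [N]. *)
Lemma map_words g d (A B : 'I_g -> 'M[C]_d) p N K' (Y' : 'I_K' -> 'M[C]_d) :
  sv_generic A -> (0 < N)%N ->
  frm_maps p A B -> vanishes_at_0 p -> derivative_at_0_is_id p ->
  ball_map B A Y' ->
  exists U Q : 'M[C]_d, [/\ U^t* *m U = 1%:M, Q^t* *m Q = 1%:M,
    forall j, Q *m A j = U *m B j *m U^t* &
    forall j w, (size w < N)%N ->
      map_coef p A (j :: w) = A j *m wordmx (fun j => (Q - 1%:M) *m A j) w].
Proof.
move=> hA N0 pAB p0 p1 BA.
have [K [W [h1 h2 h3]]] := pencil_certificate N pAB p0.
have AB : ball_map A B (fun s => usubmx (W s [::])).
  apply: (certificate_ball_map (G := fun s j => pencil_coef (slack A) (W s) j [::])) => //.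
    by move=> j; rewrite h2 // map_coef1.
  by move=> i j; rewrite h3.
have [d0 [c [YY' c1]]] := sv_generic_ball_comp hA AB BA.
have [U [k [k' [UU YE Y'E k1 k'1]]]] := proportional_unitary d0
  (fun eta => AB.1 _ eta) (fun eta => BA.1 _ eta) YY' c1.
have UU' : U *m U^t* = 1%:M by apply: mulmx1C.
have [Rt AR] := sv_generic_right_inverse hA.
have nsqU n (xi : 'I_g -> 'M[C]_(d, n)) :
    nsq (\sum_j B j *m xi j) = nsq (\sum_j A j *m (U *m xi j)).
  apply/eqP; rewrite eq_le; apply/andP; split.
    apply: le_trans (AB.2 _ _) _; rewrite -[leRHS]mul1r -k1 mulr_suml.
    apply: ler_sum => s _; rewrite YE -nsqZ scaler_sumr.
    by under eq_bigr do rewrite -scalemxAl -scalemxAr.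
  apply: le_trans (BA.2 _ _) _; rewrite -[leRHS]mul1r -k'1 mulr_suml.
  apply: ler_sum => r _; rewrite Y'E -nsqZ scaler_sumr.
  by under eq_bigr do rewrite -scalemxAl -scalemxAr (mulmxA (U^t*)) UU mul1mx.
have [Q QQ QA] := nsq_polar UU AR nsqU.
exists U, Q; split=> // j w hw.
have W0 s : W s [::] = col_mx (k s *: U) 0.
  rewrite -[LHS]vsubmxK YE; congr col_mx.
  (* The upper parts already exhaust the Gram sum, so the slack parts of the constant terms
     vanish. *)
  have W1E : \sum_s (usubmx (W s [::]))^t* *m usubmx (W s [::]) = 1%:M.
    under eq_bigr do rewrite YE adjmxZ -scalemxAl -scalemxAr scalerA -normCKC UU.
    by rewrite -scaler_suml k1 scale1r.
  have : \sum_s nsq (dsubmx (W s [::])) = 0.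
    rewrite -raddf_sum /=; apply: etrans (mxtrace0 _ _); congr (\tr _).
    apply: (addrI 1%:M); rewrite addr0 -{1}W1E -big_split -[RHS]h1 /=.
    apply: eq_bigr => s' _; rewrite -[in RHS](vsubmxK (W s' [::])).
    by rewrite tr_col_mx map_row_mx mul_row_col.
  move/eqP; rewrite psumr_eq0 => [/allP/(_ s (mem_index_enum _))/eqP/nsq_eq0//|s' _].
  exact: nsq_ge0.
have [_ /(_ j hw)] := word_rigidity h1 h2 h3 (fun j => map_coef1 B j p1) W0 k1 UU QQ QA AR (ltnW hw).
have -> : map_coef p B (j :: w) = U^t* *m (Q *m map_coef p A (j :: w)) *m U.
  rewrite /map_coef !mulmx_sumr mulmx_suml; apply: eq_bigr => i _.
  rewrite -!scalemxAr -scalemxAl; congr (_ *: _).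
  by rewrite QA !mulmxA UU mul1mx -mulmxA UU mulmx1.
have Uu : U \in unitmx by have [] := mulmx1_unit UU.
have Uu' : U^t* \in unitmx by have [] := mulmx1_unit UU.
have Qu : Q \in unitmx by have [] := mulmx1_unit QQ.
by move/(can_inj (mulmxK Uu))/(can_inj (mulKmx Uu'))/(can_inj (mulKmx Qu)).
Qed.

End SvGeneric.

(** * Resolvents and boundedness *)

Local Open Scope complex_scope.
Local Open Scope sesquilinear_scope.

(** By Cayley-Hamilton the inverse is a polynomial in [M], so subspaces invariant under [M] are
    invariant under its inverse. *)
Lemma invmx_invariant (F : fieldType) n (M : 'M[F]_n) (P : 'cV[F]_n -> Prop) v :
  M \in unitmx -> (forall x y, P x -> P y -> P (x + y)) ->
  (forall a x, P x -> P (a *: x)) -> (forall x, P x -> P (M *m x)) ->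
  P v -> P (invmx M *m v).
Proof.
case: n M P v => [|n] M P v Mu PD PZ PM Pv.
  by rewrite (flatmx0 (_ *m v)) -(flatmx0 v).
have Pq (q : {poly F}) : forall x, P x -> P (horner_mx M q *m x).
  elim/poly_ind: q => [|q c IHq] x Px.
    by rewrite rmorph0 mul0mx -(scale0r x); exact: PZ.
  rewrite rmorphD rmorphM /= horner_mx_X horner_mx_C mulmxDl.
  apply: PD; first by rewrite -[_ * _]/(_ *m _) -mulmxA; exact/IHq/PM.
  by rewrite mul_scalar_mx; exact: PZ.
pose p := char_poly M; set c := p.[0].
have c0 : c != 0.
  rewrite /c horner_coef0 /p char_poly_det mulf_eq0 negb_or.
  by rewrite signr_eq0 /= -unitfE -unitmxE.
have /factor_theorem[q qE] : root (p - c%:P) 0.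
  by rewrite /root !hornerE subrr.
have qM : horner_mx M q *m M = (- c)%:M.
  have := congr1 (horner_mx M) qE.
  rewrite subr0 rmorphM /= horner_mx_X rmorphB /= Cayley_Hamilton horner_mx_C.
  by rewrite sub0r raddfN.
have -> : invmx M = (- c)^-1 *: horner_mx M q.
  rewrite -[horner_mx M q](mulmxK Mu) qM mul_scalar_mx scalerA mulVf ?scale1r //.
  by rewrite oppr_eq0.
by rewrite -scalemxAl; exact/PZ/Pq.
Qed.

Section Final.
Variable R : realType.
Local Notation C := R[i].

(* [Z] lies in [V (x) C^n], where [V] is spanned by the vectors [E_w b]: the
   inverse of [1 - Lambda_E(X)] is a polynomial in it by Cayley-Hamilton. *)
Lemma annihilated_solution g (r : free_rational R g) n (X : 'I_g -> 'M[C]_n)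
    (y : 'rV[C]_n) (Z : 'M[C]_(fr_dim r, n)) (ew : seq 'I_g -> 'cV[C]_(fr_dim r))
    k (D : 'M[C]_(k, fr_dim r)) :
  ew [::] = fr_b r -> (forall j w, ew (j :: w) = fr_E r j *m ew w) ->
  fr_regular r X ->
  Z - \sum_j fr_E r j *m Z *m (X j)^T = fr_b r *m y ->
  (forall w, D *m ew w = 0) -> D *m Z = 0.
Proof.
move=> ew0 ewS reg ZE De.
pose P (v : 'cV[C]_(fr_dim r * n)) := forall k (D : 'M[C]_(k, fr_dim r)), (forall w, D *m ew w = 0) ->
  D *m untvec v = 0.
have uD (a b : 'cV[C]_(fr_dim r * n)) : untvec (a + b) = untvec a + untvec b.
  by apply/matrixP => i j; rewrite !mxE.
have uZ c (a : 'cV[C]_(fr_dim r * n)) : untvec (c *: a) = c *: untvec a.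
  by apply/matrixP => i j; rewrite !mxE.
suff : P (tvec Z) by move/(_ _ _ De); rewrite tvecK.
have -> : tvec Z = invmx (1%:M - Lambda (fr_E r) X) *m tvec (fr_b r *m y).
  by rewrite -ZE tvecD tvecN -LambdaE_tvec -{2}[tvec Z]mul1mx -mulmxBl mulKmx.
apply: (invmx_invariant (P := P)) => //.
- by move=> a b Pa Pb k' D' D'e; rewrite uD mulmxDr Pa // Pb // addr0.
- by move=> c a Pa k' D' D'e; rewrite uZ -scalemxAr Pa // scaler0.
- move=> a Pa k' D' D'e; rewrite mulmxBl mul1mx uD mulmxDr Pa // add0r.
  rewrite -scaleN1r uZ -scalemxAr -[a]untvecK LambdaE_tvec tvecK mulmx_sumr.
  rewrite big1 ?scaler0 // => j _; rewrite !mulmxA.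
  rewrite (Pa _ (D' *m fr_E r j)) ?mul0mx // => w.
  by rewrite -mulmxA -ewS D'e.
by move=> k' D' D'e; rewrite tvecK mulmxA -ew0 D'e mul0mx.
Qed.

Lemma normc_ge0 (a : C) : 0 <= ComplexField.Normc.normc a.
Proof. by case: a => x y /=; exact: sqrtr_ge0. Qed.

Lemma normc_opnorm1 (a : C) : ComplexField.Normc.normc a <= opnorm (a%:M : 'M[C]_1).
Proof.
have l2E (v : 'cV[C]_1) : l2norm v = ComplexField.Normc.normc (v 0 0).
  rewrite /l2norm big_ord1 sqrtr_sqr ger0_norm //.
  exact: normc_ge0.
rewrite /opnorm; set S := (X in sup X); apply: sup_upper_bound; last first.
  exists 1%:M; last by rewrite mulmx1 l2E mxE mulr1n.
  by change (l2norm (1%:M : 'cV[C]_1) <= 1); rewrite l2E mxE ComplexField.Normc.normc1.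
split.
  exists (l2norm (a%:M *m (0 : 'cV[C]_1))), 0 => //.
  by change (l2norm (0 : 'cV[C]_1) <= 1); rewrite l2E mxE ComplexField.Normc.normc0.
exists (ComplexField.Normc.normc a) => _ [v /= v1 <-].
rewrite l2E mul_scalar_mx mxE ComplexField.Normc.normcM.
by rewrite -[leRHS]mulr1 ler_wpM2l ?normc_ge0 // -l2E.
Qed.

(** Along a linear relation the pencil is constantly the identity, so a nontrivial relation would
    put a whole line of scalar points in the spectrahedron. *)
Lemma bounded_free_spectrahedron_free g d (A : 'I_g -> 'M[C]_d) (c : 'I_g -> C) :
  bounded_free_spectrahedron A -> \sum_j c j *: A j = 0 -> forall j, c j = 0.
Proof.
case=> N bd cA j; apply: ComplexField.Normc.eq0_normc; apply: contrapT => /eqP cj.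
have cj0 : 0 < ComplexField.Normc.normc (c j).
  rewrite lt_neqAle eq_sym cj /=; exact: normc_ge0.
(* Chosen so that the [j]-th scalar of the point has modulus exactly 1 more than the absolute value
   of [N]. *)
pose t : R := (`|N| + 1) / ComplexField.Normc.normc (c j).
have t0 : 0 < t by rewrite divr_gt0 // ltr_wpDl.
pose X k : 'M[C]_1 := (t%:C * c k)%:M.
have XA : free_spectrahedron A X.
  apply/free_spectrahedronP => W; rewrite /pencil_form.
  have -> : \sum_k W^t* *m A k *m W *m (X k)^T =
    t%:C *: (W^t* *m (\sum_k c k *: A k) *m W).
    rewrite mulmx_sumr mulmx_suml scaler_sumr; apply: eq_bigr => k _.
    by rewrite /X tr_scalar_mx mul_mx_scalar -scalemxAr -scalemxAl scalerA.
  by rewrite cA mulmx0 mul0mx scaler0 adjmx0 !addr0 gram_trace_ge0.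
have : opnorm (X j) <= N by apply: le_trans (bd _ _ XA); exact: le_bigmax.
move/(le_trans (normc_opnorm1 _)); rewrite ComplexField.Normc.normcM.
have -> : ComplexField.Normc.normc (t%:C) = t.
  by rewrite /= expr0n /= addr0 sqrtr_sqr ger0_norm // ltW.
rewrite divfK ?gt_eqF // => /le_trans/(_ (ler_norm N)).
by rewrite gerDl ler10.
Qed.

End Final.

(** * The convexotonic map *)

Section Assembly.
Variable R : realType.
Local Notation C := R[i].

Section Words.
Variables (g d : nat) (A S : 'I_g -> 'M[C]_d) (Xi : 'I_g -> 'M[C]_g).
Hypothesis Afree : forall c : 'I_g -> C, \sum_j c j *: A j = 0 -> forall j, c j = 0.
Hypothesis XiE : structure_matrices A S Xi.

Lemma free_tuple_inj (c c' : 'I_g -> C) :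
  \sum_j c j *: A j = \sum_j c' j *: A j -> forall j, c j = c' j.
Proof.
move=> h j; apply/eqP; rewrite -subr_eq0; apply/eqP.
apply: (Afree (c := fun j => c j - c' j)).
by under eq_bigr do rewrite scalerBl; rewrite sumrB h subrr.
Qed.

Lemma structure_words w j : A j *m wordmx S w = \sum_i wordmx Xi w j i *: A i.
Proof.
elim: w j => [|k w IHw] j.
  rewrite mulmx1 (bigD1 j) //= mxE eqxx scale1r big1 ?addr0 // => i /negbTE ij.
  by rewrite mxE eq_sym ij scale0r.
rewrite /= mulmxA XiE mulmx_suml.
transitivity (\sum_s \sum_i (Xi k j s * wordmx Xi w s i) *: A i).
  apply: eq_bigr => s _; rewrite -scalemxAl IHw scaler_sumr.
  by apply: eq_bigr => i _; rewrite scalerA.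
rewrite exchange_big; apply: eq_bigr => i _ /=.
by rewrite mxE scaler_suml.
Qed.

(** Expand [A l *m S k *m S j] in two ways: by acting twice on the module, and by first expanding
    [S k *m S j = (Q - 1%:M) *m (A k *m S j)] in the [S s]. Independence of the [A s] compares
    coefficients. *)
Lemma structure_convexotonic (Q : 'M[C]_d) :
  (forall j, S j = (Q - 1%:M) *m A j) -> convexotonic Xi.
Proof.
move=> SE j k; apply/matrixP => l t.
have := structure_words [:: k; j] l; rewrite /= !mulmx1.
have -> : S k *m S j = \sum_s Xi j k s *: S s.
  rewrite {1}SE -mulmxA XiE mulmx_sumr; apply: eq_bigr => s _.
  by rewrite -scalemxAr -SE.
have -> : A l *m (\sum_s Xi j k s *: S s) =
    \sum_t (\sum_s Xi j k s *: Xi s) l t *: A t.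
  rewrite mulmx_sumr.
  transitivity (\sum_s \sum_i (Xi j k s * Xi s l i) *: A i).
    apply: eq_bigr => s _; rewrite -scalemxAr XiE scaler_sumr.
    by apply: eq_bigr => i _; rewrite scalerA.
  rewrite exchange_big; apply: eq_bigr => i _ /=.
  rewrite summxE scaler_suml; apply: eq_bigr => s _.
  by rewrite mxE.
by move/free_tuple_inj/(_ t).
Qed.

End Words.

(** The realizations of [p] need not be minimal, so equal coefficients do not at once give equal
    domains. At each regular point the states of [p] are mapped to solutions of the system for [Xi],
    which shows that its resolvent exists. *)
Lemma wordmx_convexotonic_map g (p : free_rational_map R g) (Xi : 'I_g -> 'M[C]_g) :
  vanishes_at_0 p ->
  (forall i j w, fr_coef (p i) (j :: w) = wordmx Xi w j i) ->
  is_convexotonic_map p Xi.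
Proof.
move=> p0 pw n X reg.
have sol i a : exists H : 'M[C]_(g, n),
    H - \sum_k Xi k *m H *m (X k)^T = delta_mx i a /\
    delta_mx 0 a *m (frm_eval p X i)^T = \sum_k row k H *m (X k)^T.
  have [ew [ew0 ewS ewc]] := fr_state_exists (p i).
  pose y : 'rV[C]_n := delta_mx 0 a.
  have [Z ZE] := fr_eval_exists y (reg i).
  pose E := fr_E (p i); pose c := fr_c (p i).
  (* An observability map: it sends the state [ew w] to column [i] of [wordmx Xi w]. *)
  pose O := \matrix_j (c^t* *m E j).
  have Oew w : O *m ew w = col i (wordmx Xi w).
    apply/colP => j; rewrite [RHS]mxE -pw ewc ewS mulmxA.
    rewrite !mxE; apply: eq_bigr => k _.
    by congr (_ * _); rewrite mxE.
  (* The two operators agree only on the span of the vectors [ew w]; the state [Z] has its columns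
     there. *)
  have kill k : O *m E k *m Z = Xi k *m O *m Z.
    apply/eqP; rewrite -subr_eq0 -mulmxBl; apply/eqP.
    apply: (annihilated_solution ew0 ewS (reg i) ZE) => w.
    by rewrite mulmxBl -!mulmxA -ewS !Oew /= !colE mulmxA subrr.
  exists (O *m Z); split.
    transitivity (O *m (Z - \sum_j E j *m Z *m (X j)^T)).
      rewrite mulmxBr mulmx_sumr; congr (_ - _); apply: eq_bigr => k _.
      by rewrite !mulmxA kill.
    rewrite ZE -ew0 mulmxA Oew /= /y.
    apply/matrixP => j b; rewrite !mxE big_ord1 !mxE eqxx /=.
    by rewrite eq_sym; case: (i == j); rewrite ?mul1r ?mul0r // (eq_sym a).
  rewrite (fr_eval_solve (reg i) ZE).
  have ZE' : Z = fr_b (p i) *m y + \sum_j E j *m Z *m (X j)^T by rewrite -ZE subrK.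
  rewrite {1}ZE'.
  have cb : (fr_c (p i))^t* *m fr_b (p i) = 0.
    by rewrite -ew0 [LHS]mx11_scalar -ewc p0 raddf0.
  rewrite mulmxDr (mulmxA _ (fr_b _)) cb mul0mx add0r mulmx_sumr.
  apply: eq_bigr => k _.
  by rewrite !mulmxA row_mul rowK.
have [H HE] := fin_all_exists (fun i => fin_all_exists (sol i)).
(* The solutions for all basis inputs are the columns of a right inverse, which is two-sided because
   the matrix is square. *)
pose T : 'M[C]_(g * n) := \matrix_(x, z)
  tvec (H (mxtens_unindex z).1 (mxtens_unindex z).2) x 0.
have LT : (1%:M - Lambda Xi X) *m T = 1%:M.
  apply: trmx_inj; apply/row_matrixP => z; rewrite -!tr_col; congr (_^T).
  rewrite [LHS]colE -mulmxA -colE; case: (mxtens_indexP z) => i a.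
  have -> : col (mxtens_index (i, a)) T = tvec (H i a).
    by apply/colP => x; rewrite mxE mxE mxtens_indexK.
  rewrite mulmxBl mul1mx LambdaE_tvec -tvecN -tvecD (HE i a).1.
  apply/colP => x; rewrite mxE !mxE; case: (mxtens_indexP x) => k l.
  rewrite mxtens_indexK /= (can_eq (@mxtens_indexK _ _)) xpair_eqE.
  by [].
have [Lu _] := mulmx1_unit LT; split=> // i.
have invE : invmx (1%:M - Lambda Xi X) = T.
  by rewrite -[RHS](mulKmx Lu) LT mulmx1.
apply: trmx_inj; apply/row_matrixP => a.
rewrite rowE (HE i a).2 rowE /convexotonic_map linear_sum mulmx_sumr.
apply: eq_bigr => k _ /=; rewrite trmx_mul mulmxA; congr (_ *m _).
apply/rowP => l; rewrite -rowE !mxE invE !mxE !mxtens_indexK.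
by [].
Qed.

Lemma mem_tuple_span g d (A : 'I_g -> 'M[C]_d) j : A j \in tuple_span A.
Proof. by apply: memv_span; apply: map_f; rewrite mem_enum. Qed.

Lemma tuple_span_mul g d (A B D : 'I_g -> 'M[C]_d) :
  (forall j k, A j *m B k \in tuple_span D) ->
  forall S T, S \in tuple_span A -> T \in tuple_span B -> S *m T \in tuple_span D.
Proof.
move=> AB S T.
have spanP (E : 'I_g -> 'M[C]_d) X : X \in tuple_span E ->
    exists c : 'I_g -> C, X = \sum_j c j *: E j.
  move=> /(@coord_span _ _ _ (map_tuple E (ord_tuple g))) XE.
  exists (fun j => coord (map_tuple E (ord_tuple g)) j X).
  by rewrite {1}XE; apply: eq_bigr => j _; rewrite -tnth_nth tnth_map tnth_ord_tuple.
move=> /spanP[c ->] /spanP[c' ->].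
rewrite mulmx_suml; apply: memv_suml => j _.
rewrite mulmx_sumr; apply: memv_suml => k _.
by rewrite -scalemxAl -scalemxAr !memvZ.
Qed.

End Assembly.

Theorem theorem1p5 (R : realType) (g d e : nat)
    (A : 'I_g -> 'M[R[i]]_d) (B : 'I_g -> 'M[R[i]]_e)
    (p : free_rational_map R g)
    (hA : sv_generic A) (hB : sv_generic B)
    (hbdd : bounded_free_spectrahedron A)
    (hp : birational_between p A B)
    (hp0 : vanishes_at_0 p) (hp1 : derivative_at_0_is_id p) :
  exists de : d = e, exists C : 'M[R[i]]_d,
    let S := fun j => (C - 1%:M) *m A j in
    [/\ exists2 U : 'M[R[i]]_d, U \is unitarymx &
          forall j, B j = castmx (de, de) (U^t* *m (C *m A j) *m U),
        is_matrix_algebra (tuple_span S),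
        is_right_module (tuple_span A) (tuple_span S) &
        forall Xi : 'I_g -> 'M[R[i]]_g, structure_matrices A S Xi ->
          convexotonic Xi /\ is_convexotonic_map p Xi].
Proof.
have [pAB [q [qBA qp _]]] := hp.
have [q0 q1] := inverse_coef pAB qBA qp hp0 hp1.
have [K [Y AB]] := map_ball_certificate pAB hp0 hp1.
have [K' [Y' BA]] := map_ball_certificate qBA q0 q1.
have de : d = e.
  apply/eqP; rewrite eqn_leq.
  by rewrite (sv_generic_ball_dim hA AB BA) (sv_generic_ball_dim hB BA AB).
move: B hB hp pAB qBA qp Y AB Y' BA; case: e / de => B hB hp pAB qBA qp Y AB Y' BA.
exists erefl.
(* Length 2 reaches the coefficients of words of two letters, which already fix the products
   [A j *m S k]. *)
have [U [Q [UU QQ QA words2]]] := map_words hA (isT : (0 < 2)%N) pAB hp0 hp1 BA.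
exists Q => S.
have UU' : U *m U^t* = 1%:M by apply: mulmx1C.
have AS j k : A j *m S k = \sum_i fr_coef (p i) [:: j; k] *: A i.
  by have := words2 j [:: k] isT; rewrite /map_coef /= mulmx1 => <-.
have [L LA] := sv_generic_left_inverse hA.
have left (X : 'M[R[i]]_d) : X = \sum_j L j *m (A j *m X).
  rewrite -[LHS]mul1mx -LA mulmx_suml.
  by apply: eq_bigr => j _; rewrite mulmxA.
have words j w : map_coef p A (j :: w) = A j *m wordmx S w.
  have [U' [Q' [_ _ _ wordsN]]] :=
    map_words (N := (size w).+2) hA isT pAB hp0 hp1 BA.
  (* The matrix [Q'] depends on the truncation length, but the tuple it defines does not: two-letter
     words give all [A i *m S k], and the left inverse [L] recovers [S k]. *)
  suff SE : S = (fun k => (Q' - 1%:M) *m A k) by rewrite SE; exact: wordsN.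
  apply/funext => k; rewrite [LHS]left [RHS]left; apply: eq_bigr => i _.
  have := wordsN i [:: k] isT; rewrite (words2 i [:: k] isT) /= !mulmx1.
  by move/(congr1 (mulmx (L i))).
split.
- exists U; first exact/unitarymxP.
  move=> j; rewrite castmx_id QA !mulmxA UU mul1mx -mulmxA UU mulmx1 //.
- apply: tuple_span_mul => j k; rewrite /S -[X in X *m _]/((Q - 1%:M) *m A j).
  (* Left multiplication by [Q - 1%:M] carries the module relation for [A j *m S k] to an expansion
     of [S j *m S k] in the [S i]. *)
  rewrite -mulmxA -/(S k) AS mulmx_sumr; apply: memv_suml => i _.
  by rewrite -scalemxAr memvZ // (mem_tuple_span S).
- apply: tuple_span_mul => j k; rewrite AS; apply: memv_suml => i _.
  by rewrite memvZ // mem_tuple_span.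
move=> Xi XiE; have Afree := fun c => @bounded_free_spectrahedron_free R g d A c hbdd.
split; first exact: (structure_convexotonic Afree XiE (Q := Q)).
apply: wordmx_convexotonic_map => // i j w.
have := words j w; rewrite (structure_words XiE) /map_coef.
by move/(free_tuple_inj Afree)/(_ i).
Qed.
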